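(* Let $\Omega\subset\mathbb{R}^n$ be open and let $K\subset\Omega$ be a compact set of $(s,1)$-capacity zero. Then any nonlocal minimal graph in $\Omega\setminus K$ is a nonlocal minimal graph in $\Omega$. That is, if $u:\mathbb{R}^n\to\mathbb{R}$ is measurable and its subgraph $\mathcal{S}_u=\{(x,t)\in\mathbb{R}^n\times\mathbb{R}: t<u(x)\}$ is locally $s$-minimal in $(\Omega\setminus K)\times\mathbb{R}$, then $\mathcal{S}_u$ is locally $s$-minimal in $\Omega\times\mathbb{R}$.
   Context: Fix $n\in\mathbb{N}$ and $s\in(0,1)$. Nonlocal minimal graphs. For measurable $A,B\subset\mathbb{R}^{n+1}$ let $L_s(A,B)=\int_A\int_B\frac{\mathrm{d}Y\,\mathrm{d}X}{|X-Y|^{n+1+s}}$. The $s$-perimeter of a measurable set $E\subset\mathbb{R}^{n+1}$ in an open set $\mathcal{O}\subset\mathbb{R}^{n+1}$ is $\mathrm{Per}_s(E,\mathcal{O})=L_s(E\cap\mathcal{O},\mathbb{R}^{n+1}\setminus E)+L_s(E\setminus\mathcal{O},\mathcal{O}\setminus E)$. A measurable set $E$ is $s$-minimal in $\mathcal{O}$ if $\mathrm{Per}_s(E,\mathcal{O})<\infty$ and $\mathrm{Per}_s(E,\mathcal{O})\le\mathrm{Per}_s(F,\mathcal{O})$ for every (measurable) $F\subset\mathbb{R}^{n+1}$ with $F\setminus\mathcal{O}=E\setminus\mathcal{O}$. $E$ is locally $s$-minimal in $\mathcal{O}$ if it is $s$-minimal in every open set $\mathcal{O}'\Subset\mathcal{O}$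 (i.e. $\overline{\mathcal{O}'}$ compact and contained in $\mathcal{O}$). For an open set $U\subset\mathbb{R}^n$, $\partial E$ is called a nonlocal minimal graph in $U$ if $E$ is locally $s$-minimal in $U\times\mathbb{R}$ and $E=\mathcal{S}_u=\{(x,t):t<u(x)\}$ for some measurable function $u:\mathbb{R}^n\to\mathbb{R}$. Capacity. $[v]_{W^{s,1}(\mathbb{R}^n)}=\int_{\mathbb{R}^n}\int_{\mathbb{R}^n}\frac{|v(x)-v(y)|}{|x-y|^{n+s}}\,\mathrm{d}y\,\mathrm{d}x$. For open $U\subset\mathbb{R}^n$ and compact $F\subset U$, $\mathrm{cap}_{s,1}(F,U)=\inf [v]_{W^{s,1}(\mathbb{R}^n)}$ over all $v\in C_c^\infty(U)$ with $v\ge1$ on $F$. For open $G\subset U$, $\mathrm{cap}_{s,1}(G,U)=\sup\{\mathrm{cap}_{s,1}(F,U): F\subset G \text{ compact}\}$; for arbitrary $A\subset U$, $\mathrm{cap}_{s,1}(A,U)=\inf\{\mathrm{cap}_{s,1}(G,U): G\text{ open}, A\subset G\subset U\}$. A set $A\subset\mathbb{R}^n$ is of $(s,1)$-capacity zero if $\mathrm{cap}_{s,1}(A\cap U,U)=0$ for all open $U\subset\mathbb{R}^n$. *)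

(* Defs.v *)
From HB Require Import structures.
From mathcomp Require Import all_boot all_order all_algebra.
From mathcomp Require Import all_classical all_reals all_analysis.
Import Order.TTheory GRing.Theory Num.Theory.
Import numFieldNormedType.Exports.

Set Implicit Arguments.
Unset Strict Implicit.
Unset Printing Implicit Defensive.

Local Open Scope classical_set_scope.
Local Open Scope ring_scope.

(* R^n is 'rV[R]_n, which carries the product topology; its library norm is
   the sup norm, hence the separate Euclidean norm [enorm]. *)

Section lebesgue_outer.
Context {R : realType} {n : nat}.
Local Open Scope ereal_scope.

Definition box (a b : 'rV[R]_n) : set 'rV[R]_n :=
  [set x | forall i, x ord0 i \in `]a ord0 i, b ord0 i]].

Definition box_volume (a b : 'rV[R]_n) : R :=
  (\prod_(i < n) Num.max 0 (b ord0 i - a ord0 i))%R.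

(* Lebesgue outer measure: coverings by countably many boxes, possibly none
   (D = set0), so that the empty set is null in dimension 0 as well. *)
Definition lebesgue_outer (A : set 'rV[R]_n) : \bar R :=
  ereal_inf [set r | exists (D : set nat) (a b : nat -> 'rV[R]_n),
    A `<=` \bigcup_(k in D) box (a k) (b k) /\
    r = \esum_(k in D) (box_volume (a k) (b k))%:E].

Lemma box_volume_ge0 a b : (0 <= box_volume a b)%R.
Proof. by apply: prodr_ge0 => i _; rewrite le_max lexx. Qed.

Lemma lebesgue_outer_ge0 A : 0 <= lebesgue_outer A.
Proof.
apply: le_ereal_inf_tmp => _ [D [a [b [_ ->]]]].
by apply: esum_ge0 => k _; rewrite lee_fin box_volume_ge0.
Qed.

Lemma le_lebesgue_outer : {homo lebesgue_outer : A B / A `<=` B >-> A <= B}.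
Proof.
move=> A B AB; apply: ereal_inf_le_tmp => r [D [a [b [BD ->]]]].
by exists D, a, b; split=> //; exact: subset_trans BD.
Qed.

Lemma lebesgue_outer0 : lebesgue_outer set0 = 0.
Proof.
apply/eqP; rewrite eq_le lebesgue_outer_ge0 andbT.
apply: ereal_inf_lbound; exists set0, (fun=> 0%R), (fun=> 0%R).
by split=> //; rewrite esum_set0.
Qed.

Lemma lebesgue_outer_sigma_subadditive : sigma_subadditive lebesgue_outer.
Proof.
move=> A; have [[i ioo]|] := pselect (exists i, lebesgue_outer (A i) = +oo).
  rewrite (eseries_pinfty _ _ ioo) ?leey// => k _.
  by rewrite -ltNye (lt_le_trans _ (lebesgue_outer_ge0 _)).
rewrite -forallNE => Aoo.
suff add2e (e : {posnum R}) : lebesgue_outer (\bigcup_k A k) <=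
    \sum_(i <oo) lebesgue_outer (A i) + e%:num%:E.
  by apply/lee_addgt0Pr => _/posnumP[].
rewrite (le_trans _ (epsilon_trick _ _ _))//; last first.
  by move=> k; exact: lebesgue_outer_ge0.
pose P k (c : set nat * ((nat -> 'rV[R]_n) * (nat -> 'rV[R]_n))) :=
  A k `<=` \bigcup_(j in c.1) box (c.2.1 j) (c.2.2 j) /\
  \esum_(j in c.1) (box_volume (c.2.1 j) (c.2.2 j))%:E <=
    lebesgue_outer (A k) + (e%:num / (2 ^ k.+1)%:R)%:E.
have [G PG] : {G & forall k, P k (G k)}.
  apply: (@choice _ _ P) => k; rewrite /P.
  have Afin : lebesgue_outer (A k) \is a fin_num.
    rewrite ge0_fin_numE ?lebesgue_outer_ge0// ltey.
    by apply/eqP; exact: Aoo.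
  have ek : (0 < e%:num / (2 ^ k.+1)%:R)%R by [].
  have [_ [D [a [b [AD ->]]]] lt] := lb_ereal_inf_adherent ek Afin.
  by exists (D, (a, b)); split=> //=; exact: ltW.
have /card_esym/ppcard_eqP[f] := card_nat2.
pose J := [set: nat] `*`` (fun k => (G k).1).
pose v k j := (box_volume ((G k).2.1 j) ((G k).2.2 j))%:E.
have v0 k j : 0 <= v k j by rewrite lee_fin box_volume_ge0.
apply: (@le_trans _ _ (\esum_(i in J) v i.1 i.2)).
  apply: ereal_inf_lbound; exists (f @^-1` J),
    (fun m => (G (f m).1).2.1 (f m).2), (fun m => (G (f m).1).2.2 (f m).2).
  split.
    move=> x [k _] /((PG k).1)[j Dj xj].
    by exists (f^-1%FUN (k, j)); rewrite /= invK ?inE.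
  rewrite (reindex_esum (f @^-1` J) J f)//.
  split.
  - by move=> m.
  - by move=> x y _ _; apply: (@inj _ _ setT); rewrite ?inE.
  - by move=> y Jy; exists (f^-1%FUN y); rewrite /= invK ?inE.
rewrite -esum_esum// -nneseries_esumT; last first.
  by move=> k; apply: esum_ge0 => j _; exact: v0.
apply: lee_nneseries => [k _ _|k _].
  by apply: esum_ge0 => j _; exact: v0.
exact: (PG k).2.
Qed.

HB.instance Definition _ := isOuterMeasure.Build R 'rV[R]_n lebesgue_outer
  lebesgue_outer0 lebesgue_outer_ge0 le_lebesgue_outer
  lebesgue_outer_sigma_subadditive.

End lebesgue_outer.

(* R^n with the (complete) sigma-algebra of Lebesgue-measurable sets, which
   are the Caratheodory-measurable sets of [lebesgue_outer]. *)
Definition Rn (R : realType) (n : nat) :=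
  caratheodory_type (@lebesgue_outer R n).
HB.instance Definition _ (R : realType) (n : nat) := Measurable.on (Rn R n).

Definition lebesgue_Rn {R : realType} {n : nat} : set (Rn R n) -> \bar R :=
  @lebesgue_outer R n.
HB.instance Definition _ (R : realType) (n : nat) :=
  isMeasure.Build _ (Rn R n) R (@lebesgue_Rn R n)
    (@caratheodory_measure0 _ _ (@lebesgue_outer R n))
    (@caratheodory_measure_ge0 _ _ (@lebesgue_outer R n))
    (@caratheodory_measure_sigma_additive _ _ (@lebesgue_outer R n)).

Section fractional_perimeter.
Context {R : realType}.

Definition enorm {n} (x : 'rV[R]_n) : R := Num.sqrt (\sum_(i < n) x ord0 i ^+ 2).

(* |x - y|^-(n + s) on R^n; the diagonal, where powR and the inverse take junk
   values, is negligible. *)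
Definition frac_kernel {n} (s : R) (x y : 'rV[R]_n) : R :=
  (enorm (x - y) `^ (n%:R + s))^-1.

(* Below, R^N is the ambient space; it is R^(n+1) in the case of graphs. *)
Definition interaction {N} (s : R) (A B : set 'rV[R]_N) : \bar R :=
  (\int[lebesgue_Rn]_(X in A) \int[lebesgue_Rn]_(Y in B) (frac_kernel s X Y)%:E)%E.

Definition s_perimeter {N} (s : R) (E O : set 'rV[R]_N) : \bar R :=
  (interaction s (E `&` O) (~` E) + interaction s (E `\` O) (O `\` E))%E.

Definition s_minimal {N} (s : R) (E O : set 'rV[R]_N) : Prop :=
  [/\ measurable (E : set (Rn R N)),
      (s_perimeter s E O < +oo)%E &
      forall F : set 'rV[R]_N, measurable (F : set (Rn R N)) ->
        F `\` O = E `\` O -> (s_perimeter s E O <= s_perimeter s F O)%E].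

Definition locally_s_minimal {N} (s : R) (E O : set 'rV[R]_N) : Prop :=
  forall O' : set 'rV[R]_N, open O' -> compact (closure O') ->
    closure O' `<=` O -> s_minimal s E O'.

(* A point (x, t) of R^n x R is the row vector X : 'rV_(n + 1) with
   x = lsubmx X and t = rsubmx X ord0 ord0. *)
Definition cylinder {n} (U : set 'rV[R]_n) : set 'rV[R]_(n + 1) :=
  [set X | U (lsubmx X)].

Definition subgraph {n} (u : 'rV[R]_n -> R) : set 'rV[R]_(n + 1) :=
  [set X | rsubmx X ord0 ord0 < u (lsubmx X)].

(* The graph is the boundary of E; the predicate is stated on E itself. *)
Definition nonlocal_minimal_graph {n} (s : R) (U : set 'rV[R]_n)
    (E : set 'rV[R]_(n + 1)) : Prop :=
  locally_s_minimal s E (cylinder U) /\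
  exists u : 'rV[R]_n -> R,
    measurable_fun [set: Rn R n] (u : Rn R n -> R) /\ E = subgraph u.

End fractional_perimeter.

Section capacity.
Context {R : realType} {n : nat}.
Implicit Types (v : 'rV[R]_n -> R) (s : R) (U A F G : set 'rV[R]_n).

Definition iter_partial v (js : seq 'I_n) : 'rV[R]_n -> R :=
  foldr (fun j g x => 'D_(delta_mx ord0 j) g x) v js.

Definition smooth v : Prop := forall js : seq 'I_n,
  continuous (iter_partial v js) /\
  forall j x, derivable (iter_partial v js) x (delta_mx ord0 j).

Definition test_function U v : Prop :=
  let supp := closure [set x | v x != 0] in
  [/\ smooth v, compact supp & supp `<=` U].

Definition gagliardo s v : \bar R :=
  (\int[lebesgue_Rn]_(x in setT) \int[lebesgue_Rn]_(y in setT)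
     (`|v x - v y| * frac_kernel s x y)%:E)%E.

Definition cap_compact s F U : \bar R :=
  ereal_inf [set gagliardo s v |
    v in [set v | test_function U v /\ forall x, F x -> 1 <= v x]].

Definition cap_open s G U : \bar R :=
  ereal_sup [set cap_compact s F U | F in [set F | compact F /\ F `<=` G]].

(* For an arbitrary A the outer capacity is used, also when A happens to be
   open or compact. *)
Definition cap s A U : \bar R :=
  ereal_inf [set cap_open s G U |
    G in [set G | [/\ open G, A `<=` G & G `<=` U]]].

Definition capacity_zero s A : Prop :=
  forall U, open U -> cap s (A `&` U) U = 0%E.

End capacity.

(* Main.v *)
Require Import Defs.
From HB Require Import structures.
From mathcomp Require Import all_boot all_order all_algebra.
From mathcomp Require Import all_classical all_reals all_analysis.
From mathcomp Require Import measurable_realfun lra ring.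
Import Order.TTheory GRing.Theory Num.Theory.
Import numFieldNormedType.Exports.

(** The graph structure is carried over unchanged, so the content is that
    [K * R] is removable for s-minimal sets of R^(n+1).  Write
    [frac_measure s] for the measure on pairs of points with density
    [|X - Y|^-(n+1+s)]; the s-perimeter of [E] in [O] is the mass of the pairs
    with first point in [E], second point outside [E], and at least one of the
    two in [O] ([s_perimeterE]).

    Capacity zero yields small sets around [K].  A test function [v >= 1] on
    [K] with small Gagliardo seminorm has, by the coarea inequality
    ([coarea_level]), a closed superlevel set [G = {t <= v}], [0 < t < 1], of
    small s-perimeter in R^n; it contains the open neighbourhood [{t < v}] of
    [K].  Its Lebesgue measure is small as well, because a bounded set [G] has
    a disjoint translate of a surrounding ball at bounded distance, which gives
    [|G|^2 <= C Per_s(G)] ([lebesgue_sqr_le_frac_measure]).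

    These sets are also small in R^(n+1).  Writing the kernel as a
    superposition of indicators of balls ([layer_cake]) and integrating out
    the vertical variable, the interaction of [G * (-T, T]] with the
    complement of the cylinder over [G] is at most a constant times [T] times
    the s-perimeter of [G] in R^n ([frac_measure_cylinder]).

    Let [F] compete with [E] in [O], and let [C] be the cylinder over such a
    [G].  The set that equals [E] in [C] and [F] outside [C] competes with [E]
    in [O \ C], and its perimeter there exceeds that of [F] in [O] by at most
    twice the interaction of [C & O] with the complement of [C]
    ([le_perimeter_patch]).  Since [E] is minimal in [O \ C], letting [C]
    shrink and using the Borel-Cantelli lemma gives that the perimeter of [E]
    in [O] is at most that of [F] ([s_perimeter_le_removable]).

    Finiteness of the perimeter of [E] in [O] comes from the same inequality.
    The closure of [O] is covered by a finite union [U] of balls, which has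
    finite perimeter ([open_exhaustion_finite_perimeter]), and the competitor
    [E \ U] has in [U] at most the perimeter of [U]. *)

Set Implicit Arguments.
Unset Strict Implicit.
Unset Printing Implicit Defensive.

Local Open Scope classical_set_scope.
Local Open Scope ring_scope.

(** * Lebesgue measure on R^n *)

Section lebesgue_measure_Rn.
Context {R : realType} {n : nat}.
Implicit Types (a b : 'rV[R]_n) (A : set 'rV[R]_n).

Lemma boxP a b (x : 'rV[R]_n) :
  box a b x <-> forall i, a ord0 i < x ord0 i <= b ord0 i.
Proof. by split=> xab i; have := xab i; rewrite in_itv. Qed.

Lemma lebesgue_outer_cover A (D : set nat) (a b : nat -> 'rV[R]_n) :
  A `<=` \bigcup_(k in D) box (a k) (b k) ->
  (lebesgue_outer A <= \esum_(k in D) (box_volume (a k) (b k))%:E)%E.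
Proof. by move=> Acover; apply: ereal_inf_lbound; exists D, a, b. Qed.

Lemma lebesgue_outer_box a b : (lebesgue_outer (box a b) <= (box_volume a b)%:E)%E.
Proof.
apply: (le_trans (@lebesgue_outer_cover (box a b) [set 0%N] (fun=> a) (fun=> b) _)).
  by move=> x xab; exists 0%N.
by rewrite esum_set1// lee_fin box_volume_ge0.
Qed.

Definition set_coord a (i : 'I_n) (c : R) : 'rV[R]_n :=
  \row_j if j == i then c else a ord0 j.

Let interval_length_split (x y c : R) :
  Num.max 0 (y - x) = Num.max 0 (Num.min y c - x) + Num.max 0 (y - Num.max x c).
Proof.
have max0 (z : R) : z <= 0 -> Num.max 0 z = 0 by move=> ?; rewrite max_l.
have max1 (z : R) : 0 <= z -> Num.max 0 z = z by move=> ?; rewrite max_r.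
case: (leP x y) => xy; last first.
  by rewrite !max0 ?addr0// subr_le0 ?le_max ?ge_min ltW.
case: (leP y c) => yc.
  rewrite (max_r (le_trans xy yc)) [X in _ = _ + X]max0 ?addr0//.
  by rewrite subr_le0.
case: (leP x c) => xc; last by rewrite [X in _ = X + _]max0 ?add0r// subr_le0 ltW.
by rewrite !max1 ?subr_ge0 ?(ltW yc)//; lra.
Qed.

(** Cutting a box by a coordinate hyperplane produces two boxes whose volumes
    add up, degenerate boxes included; this is what makes half-spaces
    Caratheodory measurable. *)
Lemma box_volume_split a b i c :
  box_volume a b =
    box_volume a (set_coord b i (Num.min (b ord0 i) c)) +
    box_volume (set_coord a i (Num.max (a ord0 i) c)) b.
Proof.
pose p := \prod_(j < n | j != i) Num.max 0 (b ord0 j - a ord0 j).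
have prodE (a' b' : 'rV[R]_n) :
    (forall j, j != i -> a' ord0 j = a ord0 j /\ b' ord0 j = b ord0 j) ->
    box_volume a' b' = Num.max 0 (b' ord0 i - a' ord0 i) * p.
  move=> ab'; rewrite /box_volume (bigD1 i)//=; congr (_ * _).
  by apply: eq_bigr => j /ab'[-> ->].
rewrite !prodE.
- by rewrite -mulrDl !mxE eqxx -interval_length_split.
- by move=> j ji; rewrite !mxE (negbTE ji).
- by move=> j ji; rewrite !mxE (negbTE ji).
- by [].
Qed.

Lemma measurable_halfspace (i : 'I_n) (c : R) :
  measurable [set x : Rn R n | x ord0 i <= c].
Proof.
apply: (@le_caratheodory_measurable R _ (@lebesgue_outer R n)) => A.
apply: le_ereal_inf_tmp => _ [D [a [b [AD ->]]]].
have esumE : \esum_(k in D) (box_volume (a k) (b k))%:E =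
  (\esum_(k in D) (box_volume (a k) (set_coord (b k) i (Num.min (b k ord0 i) c)))%:E +
   \esum_(k in D) (box_volume (set_coord (a k) i (Num.max (a k ord0 i) c)) (b k))%:E)%E.
  rewrite -esumD; last 2 first.
  - by move=> k _; rewrite lee_fin box_volume_ge0.
  - by move=> k _; rewrite lee_fin box_volume_ge0.
  by apply: eq_esum => k _; rewrite -EFinD -box_volume_split.
rewrite esumE; apply: leeD; apply: lebesgue_outer_cover.
- move=> x [/AD[k Dk /boxP xk] /= xc]; exists k => //=; apply/boxP => j.
  have /andP[axj xbj] := xk j; rewrite mxE axj/=.
  by case: eqP => [ji|//]; rewrite le_min -ji xbj ji.
- move=> x [/AD[k Dk /boxP xk] /= /negP]; rewrite -ltNge => xc.
  exists k => //=; apply/boxP => j.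
  have /andP[axj xbj] := xk j; rewrite mxE xbj andbT.
  by case: eqP => [ji|//]; rewrite gt_max -ji axj ji xc.
Qed.

Lemma measurable_coord (i : 'I_n) :
  measurable_fun [set: Rn R n] (fun x : Rn R n => x ord0 i : R).
Proof.
apply: (measurability _ (RGenOInfty.measurableE R)) => _ [_ [c ->] <-].
rewrite setTI [X in measurable X](_ : _ = ~` [set x : Rn R n | x ord0 i <= c]).
  by apply: measurableC; exact: measurable_halfspace.
by apply/seteqP; split => x /=; rewrite in_itv/= andbT ltNge => /negP.
Qed.

Lemma ball_rV_coord (x y : 'rV[R]_n) (e : R) :
  ball x e y <-> 0 < e /\ forall i, `|x ord0 i - y ord0 i| < e.
Proof.
split=> [[e0 xy]|[e0 xy]]; split=> // i; first exact: xy.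
by move=> j; rewrite !ord1; exact: xy.
Qed.

Lemma measurable_ball_rV (x : 'rV[R]_n) (e : R) :
  measurable (ball x e : set (Rn R n)).
Proof.
have [e0|e0] := ltP 0 e; last first.
  rewrite [X in measurable X](_ : _ = set0)//.
  by apply/seteqP; split => y // /ball_rV_coord[]; rewrite ltNge e0.
rewrite [X in measurable X](_ : _ =
    \bigcap_(i in [set: 'I_n]) [set y : Rn R n | `|x ord0 i - y ord0 i| < e]).
  apply: fin_bigcap_measurable => // i _.
  rewrite -[X in measurable X]setTI.
  exact: (@measurable_coord i measurableT _ (measurable_ball (x ord0 i) e)).
by apply/seteqP; split => y => [/ball_rV_coord[_ xy] i _|xy]; [exact: xy|
  apply/ball_rV_coord; split => // i; exact: xy].
Qed.

(** An open set is the union of the countably many balls with rational centre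
    and radius the inverse of an integer that it contains. *)
Lemma measurable_open_rV (O : set 'rV[R]_n) :
  open O -> measurable (O : set (Rn R n)).
Proof.
move=> openO.
pose r (q : 'rV[rat]_n) : 'rV[R]_n := map_mx ratr q.
pose B (p : 'rV[rat]_n * nat) : set (Rn R n) := ball (r p.1) p.2.+1%:R^-1.
rewrite [X in measurable X](_ : _ = \bigcup_(p in [set p | B p `<=` O]) B p).
  rewrite bigcup_mkcond; apply: countable_bigcupT_measurable => // p.
  by case: ifP => // _; exact: measurable_ball_rV.
apply/seteqP; split => [x Ox|x [p /= BO Bx]]; last exact: BO.
have /nbhs_ballP[e /= e0 xO] : nbhs x O by exact: open_nbhs_nbhs.
have [k k_lt] : exists k : nat, k.+1%:R^-1 < e / 2.
  have e20 : 0 < e / 2 by rewrite divr_gt0.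
  have [k _ /(_ k) k_lt] := near_infty_natSinv_lt (PosNum e20).
  by exists k; exact: (k_lt (leqnn k)).
have k0 : 0 < k.+1%:R^-1 :> R by rewrite invr_gt0.
have /choice[q xq] : forall i, exists q : rat, x ord0 i < ratr q < x ord0 i + k.+1%:R^-1.
  move=> i; have /rat_in_itvoo[q] : x ord0 i < x ord0 i + k.+1%:R^-1 by rewrite ltrDl.
  by rewrite in_itv/= => ?; exists q.
have xB : B (\row_i q i, k) x.
  apply/ball_rV_coord; split => // i; rewrite !mxE.
  have /andP[? ?] := xq i.
  by rewrite ger0_norm ?subr_ge0 1?ltW// ltrBlDl.
exists (\row_i q i, k) => //= y /ball_rV_coord[_ qy]; apply: xO.
apply/ball_rV_coord; split => // i.
have := qy i; rewrite !mxE /= => qyi; have /andP[? ?] := xq i.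
rewrite (le_lt_trans (ler_distD (ratr (q i)) _ _))//.
rewrite (splitr e) ltrD ?(lt_trans qyi)// distrC ger0_norm ?subr_ge0 1?ltW//.
by rewrite ltrBlDl (lt_trans _ (_ : x ord0 i + k.+1%:R^-1 < _))// ltrD2l.
Qed.

Lemma lebesgue_Rn_sigma_finite : sigma_finite [set: Rn R n] (@lebesgue_Rn R n).
Proof.
exists (fun k => ball 0 k%:R).
  apply/esym/seteqP; split => // x _.
  exists (Num.trunc `|x|).+1 => //; rewrite -ball_normE /= sub0r normrN.
  by have /andP[] := trunc_itv (normr_ge0 x).
move=> k; split; first exact: measurable_ball_rV.
apply: (@le_lt_trans _ _ (lebesgue_outer (box (const_mx (- k%:R)) (const_mx k%:R)))).
  apply: le_lebesgue_outer => x /ball_rV_coord[_ xk]; apply/boxP => i; rewrite !mxE.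
  by have := xk i; rewrite mxE sub0r normrN ltr_norml => /andP[-> /ltW].
by apply: le_lt_trans (lebesgue_outer_box _ _) _; rewrite ltry.
Qed.

Lemma lebesgue_outer_translate A (v : 'rV[R]_n) :
  (lebesgue_outer [set x | A (x - v)%R] <= lebesgue_outer A)%E.
Proof.
apply: le_ereal_inf_tmp => _ [D [a [b [AD ->]]]].
rewrite (eq_esum (b := fun k => (box_volume (a k + v) (b k + v))%:E)); last first.
  move=> k _; congr EFin; apply: eq_bigr => i _; rewrite !mxE.
  by congr Num.max; rewrite opprD addrACA subrr addr0.
apply: lebesgue_outer_cover => x /AD[k Dk /boxP xk]; exists k => //; apply/boxP => i.
by have := xk i; rewrite !mxE ltrBrDr lerBlDr.
Qed.
End lebesgue_measure_Rn.

Definition slab {R : realType} {n : nat} (a b : R) : set 'rV[R]_(n + 1) :=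
  [set X | a < rsubmx X ord0 ord0 <= b].

(** A cover of [A] by boxes becomes a cover of the slab over [A] by multiplying
    each box by the interval.  This upper bound is the half of Fubini that
    carries estimates from R^n to R^(n+1). *)
Lemma lebesgue_outer_cylinder {R : realType} {n : nat} (A : set 'rV[R]_n) (c d : R) :
  c <= d ->
  (lebesgue_outer (cylinder A `&` slab c d) <= (d - c)%:E * lebesgue_outer A)%E.
Proof.
rewrite le_eqVlt => /predU1P[<-|cd].
  rewrite subrr mul0e [X in lebesgue_outer X](_ : _ = set0) ?lebesgue_outer0//.
  by apply/seteqP; split => // X [_]; rewrite /slab/=; case: ltgtP.
have dc0 : 0 < d - c by rewrite subr_gt0.
rewrite -[X in (_ <= _ * X)%E]/(ereal_inf _) -ereal_inf_pZl//.
apply: le_ereal_inf_tmp => _ [_ [D [a [b [AD ->]]]] <-].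
pose ext (e : R) (x : 'rV[R]_n) : 'rV[R]_(n + 1) := row_mx x (const_mx e).
apply: (@le_trans _ _ (\esum_(k in D) ((d - c) * box_volume (a k) (b k))%:E)).
  rewrite (eq_esum (b := fun k => (box_volume (ext c (a k)) (ext d (b k)))%:E)); last first.
    move=> k _; congr EFin; rewrite /box_volume big_split_ord/= big_ord1 mulrC.
    rewrite !row_mxEr !mxE max_r 1?ltW//; congr (_ * _).
    by apply: eq_bigr => i _; rewrite !row_mxEl.
  apply: lebesgue_outer_cover => X [/AD[k Dk /boxP Xk]]; rewrite /slab/= => Xcd.
  exists k => //; apply/boxP => i.
  rewrite -[X]hsubmxK; case: (split_ordP i) => j ->.
    by rewrite !row_mxEl; exact: Xk.
  by rewrite !row_mxEr !ord1 /const_mx !mxE; rewrite !mxE in Xcd.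
apply: ge_ereal_sup => _ [X [finX XD] <-].
under eq_fsbigr do rewrite EFinM.
rewrite -ge0_mule_fsumr; last by move=> k; rewrite lee_fin box_volume_ge0.
apply: lee_wpmul2l; first by rewrite lee_fin ltW.
apply: ereal_sup_ubound; exists X => //.
Qed.

(** * Tonelli on sets, and the measure with density the fractional kernel *)

HB.instance Definition _ (R : realType) (n : nat) :=
  Measure_isSigmaFinite.Build _ _ _ (@lebesgue_Rn R n) lebesgue_Rn_sigma_finite.

Section tonelli_on_sets.
Context d1 d2 (T1 : measurableType d1) (T2 : measurableType d2) (R : realType).
Variables (m1 : {sigma_finite_measure set T1 -> \bar R})
  (m2 : {sigma_finite_measure set T2 -> \bar R}).
Variable f : T1 * T2 -> \bar R.
Hypotheses (mf : measurable_fun setT f) (f_ge0 : forall z, (0 <= f z)%E).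
Local Open Scope ereal_scope.

Let patch_section (S : set (T1 * T2)) x :
  \int[m2]_(y in xsection S x) f (x, y) = \int[m2]_y (f \_ S) (x, y).
Proof.
rewrite integral_mkcond; apply: eq_integral => y _.
by rewrite !patchE mem_xsection.
Qed.

Let patch_ge0 (S : set (T1 * T2)) z : 0 <= (f \_ S) z.
Proof. by rewrite patchE; case: ifP. Qed.

Let measurable_patch S : measurable S -> measurable_fun setT (f \_ S).
Proof. by move=> mS; apply/(measurable_restrictT _ mS)/measurable_funTS. Qed.

Lemma integral_xsection S : measurable S ->
  \int[m1 \x m2]_(z in S) f z = \int[m1]_x \int[m2]_(y in xsection S x) f (x, y).
Proof.
move=> mS; rewrite integral_mkcond.
rewrite (fubini_tonelli1 (f \_ S) (measurable_patch mS) (patch_ge0 S)).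
by apply: eq_integral => x _; rewrite patch_section.
Qed.

Lemma measurable_integral_xsection S : measurable S ->
  measurable_fun setT (fun x => \int[m2]_(y in xsection S x) f (x, y)).
Proof.
move=> mS; under eq_fun do rewrite patch_section.
by apply: (measurable_fun_fubini_tonelli_F (f \_ S)) => //; exact: measurable_patch.
Qed.

Lemma measurable_integral_ysection S : measurable S ->
  measurable_fun setT (fun y => \int[m1]_(x in ysection S y) f (x, y)).
Proof.
move=> mS; rewrite (_ : (fun y => _) = (fun y => \int[m1]_x (f \_ S) (x, y))).
  by apply: (measurable_fun_fubini_tonelli_G (f \_ S)) => //; exact: measurable_patch.
apply/funext => y; rewrite integral_mkcond; apply: eq_integral => x _.
by rewrite !patchE mem_ysection.
Qed.

Lemma measurable_integral_l B : measurable B ->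
  measurable_fun setT (fun x => \int[m2]_(y in B) f (x, y)).
Proof.
move=> mB; have := measurable_integral_xsection (measurableX measurableT mB).
congr measurable_fun; apply/funext => x; rewrite in_xsectionX// inE//.
Qed.

Lemma measurable_integral_r A : measurable A ->
  measurable_fun setT (fun y => \int[m1]_(x in A) f (x, y)).
Proof.
move=> mA; have := measurable_integral_ysection (measurableX mA measurableT).
congr measurable_fun; apply/funext => y; rewrite in_ysectionX// inE//.
Qed.

Lemma integral_rectangle A B : measurable A -> measurable B ->
  \int[m1 \x m2]_(z in A `*` B) f z = \int[m1]_(x in A) \int[m2]_(y in B) f (x, y).
Proof.
move=> mA mB; rewrite integral_xsection; last exact: measurableX.
rewrite [RHS]integral_mkcond; apply: eq_integral => x _; rewrite patchE.
case: ifPn => xA; first by rewrite in_xsectionX.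
by rewrite notin_xsectionX// integral_set0.
Qed.

Lemma integral_ysection S : measurable S ->
  \int[m1 \x m2]_(z in S) f z = \int[m2]_y \int[m1]_(x in ysection S y) f (x, y).
Proof.
move=> mS; rewrite integral_mkcond.
rewrite (fubini_tonelli2 _ (measurable_patch mS) (patch_ge0 _)).
apply: eq_integral => y _; rewrite [RHS]integral_mkcond.
by apply: eq_integral => x _; rewrite !patchE mem_ysection.
Qed.

Lemma integral_rectangle_swap A B : measurable A -> measurable B ->
  \int[m1 \x m2]_(z in A `*` B) f z = \int[m2]_(y in B) \int[m1]_(x in A) f (x, y).
Proof.
move=> mA mB; rewrite integral_ysection; last exact: measurableX.
rewrite [RHS]integral_mkcond; apply: eq_integral => y _; rewrite patchE.
case: ifPn => yB; first by rewrite in_ysectionX.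
by rewrite notin_ysectionX// integral_set0.
Qed.

End tonelli_on_sets.

Section fractional_measure.
Context {R : realType}.

Lemma frac_kernelE n s (x y : 'rV[R]_n) :
  frac_kernel s x y = enorm (x - y) `^ (- (n%:R + s)).
Proof. by rewrite /frac_kernel powRN. Qed.

Lemma frac_kernel_ge0 n s (x y : 'rV[R]_n) : 0 <= frac_kernel s x y.
Proof. by rewrite frac_kernelE powR_ge0. Qed.

Lemma enormC n (x y : 'rV[R]_n) : enorm (x - y) = enorm (y - x).
Proof.
congr Num.sqrt; apply: eq_bigr => i _.
by rewrite !mxE -sqrrN opprB.
Qed.

Lemma frac_kernelC n s (x y : 'rV[R]_n) : frac_kernel s x y = frac_kernel s y x.
Proof. by rewrite !frac_kernelE enormC. Qed.

Lemma measurable_enorm n :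
  measurable_fun setT (fun z : Rn R n * Rn R n => enorm (z.1 - z.2)).
Proof.
apply: (measurableT_comp (continuous_measurable_fun (@sqrt_continuous R))).
apply: measurable_sum => i.
under eq_fun do rewrite !mxE.
apply: measurable_funX; apply: measurable_funB.
  exact: measurableT_comp (measurable_coord i) _.
exact: measurableT_comp (measurable_coord i) _.
Qed.

Lemma measurable_frac_kernel n s :
  measurable_fun setT (fun z : Rn R n * Rn R n => (frac_kernel s z.1 z.2)%:E).
Proof.
apply/measurable_EFinP.
under eq_fun do rewrite frac_kernelE.
apply: (measurableT_comp (measurable_powR (- (n%:R + s)))).
exact: measurable_enorm.
Qed.

Let ekernel_ge0 n s (z : Rn R n * Rn R n) : (0 <= (frac_kernel s z.1 z.2)%:E)%E.
Proof. by rewrite lee_fin frac_kernel_ge0. Qed.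

Definition frac_measure {n} (s : R) (S : set (Rn R n * Rn R n)) : \bar R :=
  (\int[lebesgue_Rn \x lebesgue_Rn]_(z in S) (frac_kernel s z.1 z.2)%:E)%E.

Section frac_measure_is_measure.
Variables (n : nat) (s : R).

Let frac_measure0 : @frac_measure n s set0 = 0%E.
Proof. exact: integral_set0. Qed.

Let frac_measure_ge0 S : (0 <= @frac_measure n s S)%E.
Proof. by apply: integral_ge0 => z _; rewrite lee_fin frac_kernel_ge0. Qed.

Let frac_measure_sigma_additive : semi_sigma_additive (@frac_measure n s).
Proof.
apply: semi_sigma_additive_nng_induced; first exact: measurable_frac_kernel.
by move=> z; rewrite lee_fin frac_kernel_ge0.
Qed.

HB.instance Definition _ := isMeasure.Build _ _ _ (@frac_measure n s)
  frac_measure0 frac_measure_ge0 frac_measure_sigma_additive.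

End frac_measure_is_measure.

Lemma interactionE n s (A B : set (Rn R n)) : measurable A -> measurable B ->
  interaction s A B = frac_measure s (A `*` B).
Proof.
move=> mA mB; rewrite /frac_measure.
by rewrite (integral_rectangle _ _ (@measurable_frac_kernel n s) (@ekernel_ge0 n s)).
Qed.

(** Tonelli, since the kernel is symmetric. *)
Lemma frac_measure_swap n s (A B : set (Rn R n)) : measurable A -> measurable B ->
  frac_measure s (A `*` B) = frac_measure s (B `*` A).
Proof.
move=> mA mB; rewrite -(interactionE _ mB mA) /frac_measure.
etransitivity.
  exact: (integral_rectangle_swap _ _ (@measurable_frac_kernel n s) (@ekernel_ge0 n s) mA mB).
apply: eq_integral => x _; apply: eq_integral => y _ /=.
by rewrite frac_kernelC.
Qed.

End fractional_measure.

(** * Integrals of powers *)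

Section power_integrals.
Context {R : realType}.
Local Notation mu := (@lebesgue_measure R).
Implicit Types p r s : R.

Lemma powRN_cvg0 p : 0 < p -> x `^ (- p) @[x --> +oo] --> (0 : R).
Proof.
move=> p0; apply/cvgrPdist_lt => e e0.
exists (e^-1 `^ p^-1); split; first exact: num_real.
move=> x ex; have x0 : 0 < x := le_lt_trans (powR_ge0 _ _) ex.
rewrite sub0r normrN ger0_norm ?powR_ge0// powRN invf_plt ?posrE ?powR_gt0//.
have -> : e^-1 = (e^-1 `^ p^-1) `^ p.
  by rewrite -powRrM mulVf ?gt_eqF// powRr1// invr_ge0 ltW.
by rewrite gt0_ltr_powR ?nnegrE ?powR_ge0 ?(ltW x0).
Qed.

Lemma powR_continuous_pos p r : 0 < r -> {for r, continuous (fun x => x `^ p)}.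
Proof.
move=> r0; apply: differentiable_continuous; apply/derivable1_diffP.
by apply: derivable_powR; rewrite in_itv/= andbT.
Qed.

Lemma integral_powR_tail p r : 0 < p -> 0 < r ->
  (\int[mu]_(x in `]r, +oo[) (p * x `^ (- p - 1))%:E = (r `^ (- p))%:E)%E.
Proof.
move=> p0 r0.
rewrite integral_itv_obnd_cbnd; last first.
  apply/measurable_funTS/measurable_EFinP; apply: measurable_funM.
    exact: measurable_cst.
  exact: measurable_powR.
rewrite (@ge0_continuous_FTC2y _ (fun x => p * x `^ (- p - 1)) (fun x => - (x `^ (- p))) _ 0).
- by rewrite EFinN oppeK add0e.
- by move=> x _; rewrite mulr_ge0 ?powR_ge0 ?ltW.
- apply: continuous_in_subspaceT => x; rewrite inE/= in_itv/= andbT => rx.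
  apply: cvgM; [exact: cvg_cst|apply: powR_continuous_pos].
  exact: lt_le_trans rx.
- by rewrite -oppr0; apply: cvgN; exact: powRN_cvg0.
- move=> x rx; apply: derivableN; apply: derivable_powR.
  by rewrite in_itv/= andbT (lt_trans r0).
- apply: cvgN; apply: cvg_at_right_filter; exact: powR_continuous_pos.
- move=> x; rewrite in_itv/= andbT => rx.
  have x0 : x \in `]0, +oo[ by rewrite in_itv/= andbT (lt_trans r0).
  rewrite derive1N; last exact: derivable_powR.
  by rewrite powR_derive1// mulNr opprK.
Qed.

(** The function is unbounded at 0, so the fundamental theorem of calculus is
    applied on [1/(k+2), 1] and passed to the limit. *)
Lemma integral_powR_near0 s : 0 < s < 1 ->
  (\int[mu]_(x in `]0%R, 1%R]) (x `^ (- s))%:E <= ((1 - s)^-1)%:E)%E.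
Proof.
move=> /andP[s0 s1].
pose F k : set (measurableTypeR R) := `[k.+2%:R^-1, 1]%classic.
have inv_lt1 k : k.+2%:R^-1 < 1 :> R by rewrite invf_lt1 ?ltr1n.
have FE : `]0%R, 1%R]%classic = \bigcup_k F k.
  apply/seteqP; split => x /=.
    rewrite in_itv/= => /andP[x0 x1].
    have := near_infty_natSinv_lt (PosNum x0) => -[k _ /(_ k.+1 (leqnSn k)) kx].
    by exists k => //; rewrite /F/= in_itv/= x1 ltW.
  move=> [k _]; rewrite /F/= !in_itv/= => /andP[kx ->].
  by rewrite (lt_le_trans _ kx)// invr_gt0.
have ndF : nondecreasing_seq F.
  move=> j k jk; apply/subsetPset => x; rewrite /F/= !in_itv/= => /andP[kx ->].
  by rewrite (le_trans _ kx)// lef_pV2 ?posrE// ler_nat ltnS.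
have mf k : measurable_fun (F k) (fun x : R => (x `^ (- s))%:E).
  by apply/measurable_funTS/measurable_EFinP; exact: measurable_powR.
have f0 k x : F k x -> (0 <= (x `^ (- s))%:E)%E by rewrite lee_fin powR_ge0.
have mF k : measurable (F k) by exact: measurable_itv.
have cvgF := @ge0_nondecreasing_set_cvg_integral _ _ _ F _ mu ndF mF mf f0.
rewrite FE -(cvg_lim _ cvgF)//; apply: lime_le; first exact: cvgP cvgF.
apply: nearW => k.
have k0 : 0 < k.+2%:R^-1 :> R by rewrite invr_gt0.
have s1' : 0 < 1 - s by rewrite subr_gt0.
rewrite (@continuous_FTC2 _ (fun x => x `^ (- s))
  (fun x => (1 - s)^-1 * x `^ (1 - s)) _ _ (inv_lt1 k)).
- rewrite powR1 mulr1 -EFinB lee_fin gerBl mulr_ge0 ?powR_ge0//.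
  by rewrite invr_ge0 ltW.
- apply: continuous_in_subspaceT => x; rewrite inE/= in_itv/= => /andP[kx _].
  by apply: powR_continuous_pos; exact: lt_le_trans kx.
- split.
  + move=> x; rewrite in_itv/= => /andP[kx _].
    apply: derivableM; first exact: derivable_cst.
    by apply: derivable_powR; rewrite in_itv/= andbT (lt_trans k0).
  + apply: cvgM; first exact: cvg_cst.
    by apply: cvg_at_right_filter; exact: powR_continuous_pos.
  + apply: cvgM; first exact: cvg_cst.
    by apply: cvg_at_left_filter; exact: powR_continuous_pos.
- move=> x; rewrite in_itv/= => /andP[kx _].
  have x0 : x \in `]0, +oo[ by rewrite in_itv/= andbT (lt_trans k0).
  rewrite derive1Ml; last exact: derivable_powR.
  by rewrite powR_derive1// mulrA mulVf ?gt_eqF// mul1r addrAC subrr add0r.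
Qed.

End power_integrals.

(** * Layer cake for negative powers *)

Section layer_cake.
Context d (T : measurableType d) (R : realType).
Variable m : {sigma_finite_measure set T -> \bar R}.
Local Notation mu := (@lebesgue_measure R).

Let superlevel (B : set T) (g : T -> R) : set (measurableTypeR R * T) :=
  [set z | B z.2 /\ g z.2 < z.1].

Let measurable_superlevel B g : measurable B -> measurable_fun setT g ->
  measurable (superlevel B g).
Proof.
move=> mB mg; apply: measurableI.
  by rewrite -[X in measurable X]setTI; apply: measurable_snd.
rewrite -[X in measurable X]setTI.
have := @measurable_fun_ltr _ _ _ setT (fun z : measurableTypeR R * T => g z.2) fst.
move=> /(_ (measurableT_comp mg measurable_snd) measurable_fst measurableT [set true]).
by apply.
Qed.

Let xsection_superlevel B g r :
  xsection (superlevel B g) r = B `&` [set y | g y < r].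
Proof. by apply/seteqP; split => y; rewrite /xsection/= inE. Qed.

Let measurable_weight p : measurable_fun setT (fun r : R => p * r `^ (- p - 1)).
Proof.
apply: measurable_funM; first exact: measurable_cst.
exact: measurable_powR.
Qed.

Lemma measurable_sublevel (B : set T) (g : T -> R) (r : R) :
  measurable B -> measurable_fun setT g -> measurable (B `&` [set y | g y < r]).
Proof.
move=> mB mg; rewrite -xsection_superlevel.
by apply: measurable_xsection; exact: measurable_superlevel.
Qed.

Lemma measurable_layer (B : set T) (g : T -> R) (p : R) :
  measurable B -> measurable_fun setT g ->
  measurable_fun setT (fun r : R =>
    (p * r `^ (- p - 1))%:E * m (B `&` [set y | (g y < r)%R]))%E.
Proof.
move=> mB mg; apply: emeasurable_funM.
  by apply/measurable_EFinP; exact: measurable_weight.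
under eq_fun do rewrite -xsection_superlevel.
by apply: measurable_fun_xsection; exact: measurable_superlevel.
Qed.

(** Since [a^-p] is the integral of [p r^(-p-1)] over [r > a], this is Tonelli
    on the set of pairs [(r, y)] with [g y < r].  The outer integral may run over
    the whole line: [g] is positive on [B], so negative radii contribute 0. *)
Lemma layer_cake (B : set T) (g : T -> R) (p : R) :
  0 < p -> measurable B -> measurable_fun setT g -> (forall y, B y -> 0 < g y) ->
  (\int[m]_(y in B) (g y `^ (- p))%:E =
   \int[mu]_r ((p * r `^ (- p - 1))%:E * m (B `&` [set y | (g y < r)%R])))%E.
Proof.
move=> p0 mB mg g0.
pose S := superlevel B g.
have mS : measurable S by exact: measurable_superlevel.
pose f (z : measurableTypeR R * T) := (p * z.1 `^ (- p - 1))%:E.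
have mf : measurable_fun setT f.
  apply/measurable_EFinP; exact: (measurableT_comp (measurable_weight p) measurable_fst).
have f0 z : (0 <= f z)%E by rewrite lee_fin mulr_ge0 ?powR_ge0 ?ltW.
transitivity (\int[m]_y \int[mu]_(x in ysection S y) f (x, y))%E.
  rewrite integral_mkcond; apply: eq_integral => y _; rewrite patchE.
  case: ifPn => yB.
    rewrite (_ : ysection S y = `]g y, +oo[%classic); last first.
      apply/seteqP; split => r; rewrite /ysection/= inE/S/= in_itv/= andbT.
        by case.
      by move=> ?; split => //; exact: set_mem.
    by rewrite /f/= integral_powR_tail// g0//; exact: set_mem.
  rewrite (_ : ysection S y = set0) ?integral_set0//.
  apply/seteqP; split => r //; rewrite /ysection/= inE/S/= => -[By _].
  by move: yB; rewrite notin_setE; exact.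
rewrite -(integral_ysection _ _ mf f0 mS) (integral_xsection _ _ mf f0 mS).
apply: eq_integral => r _; rewrite /f/= integral_cst//; last exact: measurable_xsection.
by rewrite xsection_superlevel.
Qed.

End layer_cake.

(** Two integrals of negative powers are compared through the measures of the
    sublevel sets, radius by radius.  The exponents may differ: going from
    R^(n+1) to R^n trades a factor [r] for one unit of the exponent. *)
Lemma layer_cake_le d1 d2 (T1 : measurableType d1) (T2 : measurableType d2)
  (R : realType) (m1 : {sigma_finite_measure set T1 -> \bar R})
  (m2 : {sigma_finite_measure set T2 -> \bar R}) (B1 : set T1) (B2 : set T2)
  (g1 : T1 -> R) (g2 : T2 -> R) (p1 p2 c : R) :
  0 < p1 -> 0 < p2 -> 0 <= c -> measurable B1 -> measurable B2 ->
  measurable_fun setT g1 -> measurable_fun setT g2 ->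
  (forall y, B1 y -> 0 < g1 y) -> (forall y, B2 y -> 0 < g2 y) ->
  (forall r, (p1 * r `^ (- p1 - 1))%:E * m1 (B1 `&` [set y | (g1 y < r)%R]) <=
    c%:E * ((p2 * r `^ (- p2 - 1))%:E * m2 (B2 `&` [set y | (g2 y < r)%R])))%E ->
  (\int[m1]_(y in B1) (g1 y `^ (- p1))%:E <=
    c%:E * \int[m2]_(y in B2) (g2 y `^ (- p2))%:E)%E.
Proof.
move=> p10 p20 c0 mB1 mB2 mg1 mg2 g10 g20 le12.
rewrite !layer_cake//.
have layer_ge0 (p : R) r (x : \bar R) : 0 < p -> (0 <= x -> 0 <= (p * r `^ (- p - 1))%:E * x)%E.
  by move=> p0 x0; rewrite mule_ge0// lee_fin mulr_ge0 ?powR_ge0 ?ltW.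
rewrite -ge0_integralZl_EFin//; last 2 first.
- by move=> r _; apply: layer_ge0 => //; exact: measure_ge0.
- exact: measurable_layer.
apply: ge0_le_integral => //.
- by move=> r _; apply: layer_ge0 => //; exact: measure_ge0.
- exact: measurable_layer.
- by apply: measurable_funeM; exact: measurable_layer.
Qed.

(** * The Euclidean norm, and cylinders over R^n *)

Section euclidean_norm.
Context {R : realType}.

Lemma enorm_ge0 n (x : 'rV[R]_n) : 0 <= enorm x.
Proof. exact: sqrtr_ge0. Qed.

Lemma coord_le_enorm n (x : 'rV[R]_n) i : `|x ord0 i| <= enorm x.
Proof.
rewrite -sqrtr_sqr ler_sqrt; last by apply: sumr_ge0 => j _; exact: sqr_ge0.
by rewrite (bigD1 i)//= lerDl; apply: sumr_ge0 => j _; exact: sqr_ge0.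
Qed.

Lemma enorm_gt0 n (x : 'rV[R]_n) : x != 0 -> 0 < enorm x.
Proof.
apply: contra_neqT; rewrite -leNgt => x0; apply/rowP => i; rewrite mxE.
by apply/eqP; rewrite -normr_le0 (le_trans (coord_le_enorm _ _)).
Qed.

Lemma enorm_lsubmx n (X : 'rV[R]_(n + 1)) : enorm (lsubmx X) <= enorm X.
Proof.
rewrite ler_sqrt; last by apply: sumr_ge0 => j _; exact: sqr_ge0.
rewrite [leRHS]big_split_ord/= (eq_bigr (fun i => X ord0 (lshift 1 i) ^+ 2)).
  by rewrite lerDl; apply: sumr_ge0 => j _; exact: sqr_ge0.
by move=> i _; rewrite mxE.
Qed.

End euclidean_norm.

Section cylinders.
Context {R : realType} {n : nat}.

Lemma lebesgue_outer_bigcup N (D : set nat) (F : nat -> set 'rV[R]_N) :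
  (lebesgue_outer (\bigcup_(k in D) F k) <= \esum_(k in D) lebesgue_outer (F k))%E.
Proof.
rewrite bigcup_mkcond; apply: (le_trans (lebesgue_outer_sigma_subadditive _)).
rewrite nneseries_esumT; last by move=> k; exact: lebesgue_outer_ge0.
rewrite [leRHS]esum_mkcond; apply: le_esum => k _.
by case: ifPn => // _; rewrite lebesgue_outer0.
Qed.

Lemma lebesgue_outer_cylinder_slab (A : set 'rV[R]_n) (a b : R) :
  (lebesgue_outer (cylinder A `&` slab a b)
     <= (Num.max 0 (b - a)%R)%:E * lebesgue_outer A)%E.
Proof.
have [ab|ba] := leP a b.
  by rewrite max_r ?subr_ge0//; exact: lebesgue_outer_cylinder.
rewrite max_l ?mul0e; last by rewrite subr_le0 ltW.
rewrite (_ : _ `&` _ = set0) ?lebesgue_outer0//.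
apply/seteqP; split => // X [_] /= /andP[aX Xb].
by have := lt_trans (lt_le_trans aX Xb) ba; rewrite ltxx.
Qed.

Lemma box_cylinder_slab (a b : 'rV[R]_(n + 1)) :
  box a b `<=` cylinder (box (lsubmx a) (lsubmx b)) `&`
    slab (rsubmx a ord0 ord0) (rsubmx b ord0 ord0).
Proof.
move=> X /boxP Xab; split; last by rewrite /slab/= !mxE; exact: Xab.
by apply/boxP => i; rewrite !mxE; exact: Xab.
Qed.

Lemma box_volume_cylinder (a b : 'rV[R]_(n + 1)) :
  box_volume a b = Num.max 0 (rsubmx b ord0 ord0 - rsubmx a ord0 ord0) *
    box_volume (lsubmx a) (lsubmx b).
Proof.
rewrite /box_volume big_split_ord/= big_ord1 mulrC !mxE; congr (_ * _).
by apply: eq_bigr => i _; rewrite !mxE.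
Qed.

Lemma lsubmx_continuous : continuous (lsubmx : 'rV[R]_(n + 1) -> 'rV[R]_n).
Proof.
move=> X A /nbhs_ballP[e /= e0 eA]; apply/nbhs_ballP; exists e => // Y.
move=> /ball_rV_coord[_ XY]; apply: eA; apply/ball_rV_coord; split => // i.
by rewrite !mxE; exact: XY.
Qed.

Lemma open_cylinder (U : set 'rV[R]_n) : open U -> open (@cylinder R n U).
Proof. by move=> openU; apply: open_comp => [X _|]; [exact: lsubmx_continuous|]. Qed.

Lemma closed_cylinder (U : set 'rV[R]_n) : closed U -> closed (@cylinder R n U).
Proof. by move=> closedU; apply: closed_comp => [X _|]; [exact: lsubmx_continuous|]. Qed.

(** Caratheodory measurability passes to cylinders: a covering box of R^(n+1) is
    the product of a box [Q] of R^n with an interval, and the cylinder over [A]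
    cuts it as [A] cuts [Q]. *)
Lemma measurable_cylinder (A : set (Rn R n)) :
  measurable A -> measurable (cylinder A : set (Rn R (n + 1))).
Proof.
move=> mA; apply: (@le_caratheodory_measurable R _ (@lebesgue_outer R (n + 1))) => Z.
apply: le_ereal_inf_tmp => _ [D [a [b [ZD ->]]]].
pose Q k := box (lsubmx (a k)) (lsubmx (b k)).
pose l k := Num.max 0 (rsubmx (b k) ord0 ord0 - rsubmx (a k) ord0 ord0).
have l0 k : 0 <= l k by rewrite le_max lexx.
have part (B : set 'rV[R]_n) : (lebesgue_outer (Z `&` cylinder B) <=
    \esum_(k in D) ((l k)%:E * lebesgue_outer (Q k `&` B)))%E.
  have ZB : Z `&` cylinder B `<=` \bigcup_(k in D) (cylinder (Q k `&` B) `&`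
      slab (rsubmx (a k) ord0 ord0) (rsubmx (b k) ord0 ord0)).
    by move=> X [/ZD[k Dk /box_cylinder_slab[QX sX]] BX]; exists k.
  apply: (le_trans (le_lebesgue_outer ZB)).
  apply: (le_trans (lebesgue_outer_bigcup _ _)); apply: le_esum => k _.
  exact: lebesgue_outer_cylinder_slab.
apply: (le_trans (leeD (part A) (part (~` A)))).
rewrite -esumD; last 2 first.
- by move=> k _; rewrite mule_ge0 ?lee_fin// lebesgue_outer_ge0.
- by move=> k _; rewrite mule_ge0 ?lee_fin// lebesgue_outer_ge0.
apply: le_esum => k _.
rewrite -ge0_muleDr ?lebesgue_outer_ge0// box_volume_cylinder EFinM.
apply: lee_wpmul2l; first by rewrite lee_fin.
rewrite -(mA (Q k)); exact: lebesgue_outer_box.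
Qed.

End cylinders.

(** * The kernel of R^(n+1) on cylinders *)

Section cylinder_estimate.
Context {R : realType} {n : nat}.
Local Notation lam := (@lebesgue_Rn R _).

Lemma measurable_enormB d (T : measurableType d) N (f g : T -> Rn R N) :
  measurable_fun setT f -> measurable_fun setT g ->
  measurable_fun setT (fun x => enorm (f x - g x)).
Proof.
move=> mf mg.
exact: (measurableT_comp (@measurable_enorm R N) (measurable_fun_pair mf mg)).
Qed.

Lemma measurable_lsubmx :
  measurable_fun setT (lsubmx : Rn R (n + 1) -> Rn R n).
Proof. by move=> _ A mA; rewrite setTI; exact: measurable_cylinder. Qed.

Lemma measurable_slab (a b : R) : measurable (slab a b : set (Rn R (n + 1))).
Proof.
rewrite (_ : slab a b = [set X | X ord0 (rshift n ord0) <= b] `\`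
    [set X | X ord0 (rshift n ord0) <= a]).
  by apply: measurableD; exact: measurable_halfspace.
apply/seteqP; split => X; rewrite /slab/= mxE.
  by move=> /andP[aX Xb]; split=> //; apply/negP; rewrite -ltNge.
by move=> [-> /negP]; rewrite -ltNge => ->.
Qed.

(** Integrating out the vertical variable.  A ball of radius [r] about [X] lies
    in the slab of height [2 r] over its projection, hence on the cylinder over
    [B] its measure is at most [2 r] times the measure of the projected ball
    intersected with [B]; the two layer cake formulas do the rest. *)
Lemma cylinder_kernel_le (s : R) (X : 'rV[R]_(n + 1)) (B : set (Rn R n)) :
  0 < n%:R + s -> measurable B -> ~ B (lsubmx X) ->
  (\int[lam]_(Y in cylinder B) (frac_kernel s X Y)%:E <=
   (2 * ((n + 1)%:R + s) / (n%:R + s))%:E *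
     \int[lam]_(y in B) (frac_kernel s (lsubmx X) y)%:E)%E.
Proof.
move=> p0 mB BX.
have p10 : 0 < (n + 1)%:R + s by rewrite natrD addrAC ltr_wpDr.
under eq_integral do rewrite frac_kernelE.
under [in leRHS]eq_integral do rewrite frac_kernelE.
apply: layer_cake_le.
- exact: p10.
- exact: p0.
- by rewrite divr_ge0 ?mulr_ge0 ?ltW.
- exact: measurable_cylinder.
- exact: mB.
- exact: measurable_enormB.
- exact: measurable_enormB.
- move=> Y BY; apply: enorm_gt0; apply: contra_notN BX; rewrite subr_eq0.
  by move=> /eqP ->.
- move=> y By; apply: enorm_gt0; apply: contra_notN BX; rewrite subr_eq0.
  by move=> /eqP ->.
move=> r; have [r0|r0] := leP r 0.
  rewrite (_ : _ `&` _ = set0); last first.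
    apply/seteqP; split => // Y [_ /=] /lt_le_trans /(_ r0).
    by rewrite ltNge enorm_ge0.
  rewrite measure0 mule0 mule_ge0//; last rewrite mule_ge0//.
  - by rewrite lee_fin divr_ge0 ?mulr_ge0 ?ltW.
  - by rewrite lee_fin mulr_ge0 ?powR_ge0 ?ltW.
set Br := B `&` _.
have mBr : measurable Br by apply: measurable_sublevel; [exact: mB|exact: measurable_enormB].
have sub : cylinder B `&` [set Y | enorm (X - Y) < r] `<=`
    cylinder Br `&` slab (rsubmx X ord0 ord0 - r) (rsubmx X ord0 ord0 + r).
  move=> Y [BY /= Yr]; split.
    split => //=; apply: le_lt_trans Yr; rewrite -linearB; exact: enorm_lsubmx.
  have := le_lt_trans (coord_le_enorm (X - Y) (rshift n ord0)) Yr.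
  rewrite /slab/= !mxE ltr_norml => /andP[? ?].
  by apply/andP; split; lra.
have := le_trans (le_lebesgue_outer sub) (lebesgue_outer_cylinder_slab _ _ _).
rewrite max_r; last by lra.
move=> le_meas.
apply: (le_trans (lee_wpmul2l _ le_meas)).
  by rewrite lee_fin mulr_ge0 ?powR_ge0 ?ltW.
rewrite !muleA -!EFinM le_eqVlt; apply/orP; left; apply/eqP; congr (_%:E * _)%E.
set q := - ((n + 1)%:R + s) - 1.
have -> : - (n%:R + s) - 1 = q + 1 by rewrite /q natrD; ring.
rewrite (@powRD _ r q 1); last by rewrite (gt_eqF r0) implybT.
rewrite powRr1 ?(ltW r0)//; field.
by rewrite gt_eqF.
Qed.

(** Here the kernel depends on the horizontal variable only, so that the slab
    contributes just its height. *)
Lemma slab_kernel_le (s : R) (y : 'rV[R]_n) (A : set (Rn R n)) (T : R) :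
  0 < n%:R + s -> 0 <= T -> measurable A -> ~ A y ->
  (\int[lam]_(X in cylinder A `&` slab (- T) T) (frac_kernel s (lsubmx X) y)%:E <=
   (2 * T)%:E * \int[lam]_(x in A) (frac_kernel s y x)%:E)%E.
Proof.
move=> p0 T0 mA Ay.
under eq_integral do rewrite frac_kernelE.
under [in leRHS]eq_integral do rewrite frac_kernelE.
apply: layer_cake_le.
- exact: p0.
- exact: p0.
- by rewrite mulr_ge0.
- apply: measurableI; [exact: measurable_cylinder|exact: measurable_slab].
- exact: mA.
- by apply: measurable_enormB => //; exact: measurable_lsubmx.
- exact: measurable_enormB.
- move=> X [AX _]; apply: enorm_gt0; apply: contra_notN Ay; rewrite subr_eq0.
  by move=> /eqP <-.
- move=> x Ax; apply: enorm_gt0; apply: contra_notN Ay; rewrite subr_eq0.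
  by move=> /eqP ->.
move=> r; rewrite muleCA; apply: lee_wpmul2l.
  by rewrite lee_fin mulr_ge0 ?powR_ge0 ?ltW.
have -> : 2 * T = Num.max 0 (T - - T) by rewrite max_r; lra.
apply: le_trans (lebesgue_outer_cylinder_slab _ _ _).
apply: le_lebesgue_outer => X [[AX sX] Xr]; split => //; split => //=.
by rewrite enormC.
Qed.

Lemma measurable_potential N (s : R) (B : set (Rn R N)) : measurable B ->
  measurable_fun setT
    (fun x : Rn R N => \int[lam]_(y in B) (frac_kernel s x y)%:E)%E.
Proof.
apply: (measurable_integral_l _ (@measurable_frac_kernel R N s)) => z.
by rewrite lee_fin frac_kernel_ge0.
Qed.

(** The first point contributes the height of the slab, the second one the
    integral of the kernel along a vertical line. *)
Lemma frac_measure_cylinder (s : R) (G : set (Rn R n)) (T : R) :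
  0 < n%:R + s -> 0 <= T -> measurable G ->
  (frac_measure s ((cylinder G `&` slab (- T) T : set (Rn R (n + 1))) `*` cylinder (~` G)) <=
   (4 * T * ((n + 1)%:R + s) / (n%:R + s))%:E * frac_measure s (G `*` ~` G))%E.
Proof.
move=> p0 T0 mG.
have mCG : measurable (cylinder G `&` slab (- T) T : set (Rn R (n + 1))).
  apply: measurableI; [exact: measurable_cylinder|exact: measurable_slab].
have mGc : measurable (~` G) by exact: measurableC.
have mCGc : measurable (cylinder (~` G) : set (Rn R (n + 1))) by exact: measurable_cylinder.
rewrite -(interactionE s mCG mCGc) /interaction.
pose c := 2 * ((n + 1)%:R + s) / (n%:R + s).
have c0 : 0 <= c by rewrite divr_ge0 ?mulr_ge0 ?(ltW p0)// natrD addrAC addr_ge0// ltW.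
pose f (z : Rn R (n + 1) * Rn R n) := (frac_kernel s (lsubmx z.1) z.2)%:E.
have mf : measurable_fun setT f.
  apply/measurable_EFinP; under eq_fun do rewrite frac_kernelE.
  apply: (measurableT_comp (measurable_powR (- (n%:R + s)))).
  apply: measurable_enormB; last exact: measurable_snd.
  exact: (measurableT_comp measurable_lsubmx measurable_fst).
have f0 z : (0 <= f z)%E by rewrite lee_fin frac_kernel_ge0.
apply: (@le_trans _ _ (\int[lam]_(X in cylinder G `&` slab (- T) T)
    (c%:E * \int[lam]_(y in ~` G) f (X, y)))%E).
  apply: ge0_le_integral.
  - exact: mCG.
  - by move=> X _; apply: integral_ge0 => Y _; rewrite lee_fin frac_kernel_ge0.
  - by apply/measurable_funTS; exact: measurable_potential.
  - by apply/measurable_funTS/measurable_funeM; exact: (measurable_integral_l _ mf f0).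
  - move=> X [GX _]; apply: cylinder_kernel_le; [exact: p0|exact: mGc|].
    by move/(_ GX).
rewrite ge0_integralZl_EFin; [|exact: mCG| | |exact: c0]; last 2 first.
- by move=> X _; apply: integral_ge0 => Y _; exact: f0.
- by apply/measurable_funTS; exact: (measurable_integral_l _ mf f0).
rewrite -(integral_rectangle _ _ mf f0 mCG mGc).
rewrite (integral_rectangle_swap _ _ mf f0 mCG mGc).
have -> : 4 * T * ((n + 1)%:R + s) / (n%:R + s) = c * (2 * T).
  by rewrite /c; field; rewrite gt_eqF.
rewrite (EFinM c (2 * T)) -muleA; apply: lee_wpmul2l; first by rewrite lee_fin.
rewrite (frac_measure_swap s mG mGc) -(interactionE s mGc mG) /interaction.
rewrite -ge0_integralZl_EFin; [|exact: mGc| | |by rewrite mulr_ge0]; last 2 first.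
- by move=> X _; apply: integral_ge0 => Y _; rewrite lee_fin frac_kernel_ge0.
- by apply/measurable_funTS; exact: measurable_potential.
apply: ge0_le_integral.
- exact: mGc.
- by move=> y _; apply: integral_ge0 => X _; exact: f0.
- by apply/measurable_funTS; exact: (measurable_integral_r _ mf f0).
- by apply/measurable_funTS/measurable_funeM; exact: measurable_potential.
- move=> y Gy; have := slab_kernel_le p0 T0 mG Gy; rewrite /f/=.
  exact.
Qed.

End cylinder_estimate.

(** * Fractional perimeter of balls, and an isoperimetric bound *)

Section ball_estimates.
Context {R : realType} {N : nat}.
Local Notation lam := (@lebesgue_Rn R N).
Local Notation mu := (@lebesgue_measure R).

Definition center_box (x : 'rV[R]_N) (r : R) : set 'rV[R]_N :=
  box (x - const_mx r) (x + const_mx r).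

Lemma ball_sub_center_box (x : 'rV[R]_N) (r : R) : ball x r `<=` center_box x r.
Proof.
move=> y /ball_rV_coord[_ xy]; apply/boxP => i; rewrite !mxE.
have := xy i; rewrite ltr_norml => /andP[? ?]; apply/andP; split; lra.
Qed.

Lemma lebesgue_ball_le (x : 'rV[R]_N) (r : R) : 0 <= r ->
  (lam (ball x r) <= ((2 * r) ^+ N)%:E)%E.
Proof.
move=> r0; apply: (le_trans (le_lebesgue_outer (@ball_sub_center_box x r))).
apply: (le_trans (lebesgue_outer_box _ _)); rewrite lee_fin /box_volume.
rewrite (eq_bigr (fun=> 2 * r)); first by rewrite prodr_const card_ord.
move=> i _; rewrite !mxE opprD opprK addrACA subrr add0r -mulr2n mulr_natl.
by rewrite max_r// mulrn_wge0.
Qed.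

Lemma lebesgue_ball_lty (x : 'rV[R]_N) (r : R) : (lam (ball x r) < +oo)%E.
Proof.
have [r0|r0] := leP 0 r.
  by rewrite (le_lt_trans (lebesgue_ball_le x r0))// ltry.
rewrite (_ : ball x r = set0) ?measure0//.
by apply/seteqP; split => // y /ball_rV_coord[/lt_trans/(_ r0)]; rewrite ltxx.
Qed.

Lemma enorm_lt_ball (x y : 'rV[R]_N) (r : R) : enorm (x - y) < r -> ball x r y.
Proof.
move=> xyr; apply/ball_rV_coord; split; first exact: le_lt_trans (enorm_ge0 _) xyr.
move=> i; apply: le_lt_trans xyr.
by have := coord_le_enorm (x - y) i; rewrite !mxE.
Qed.

Lemma product_lebesgue_sigma_finite :
  sigma_finite [set: Rn R N * Rn R N] (product_measure1 lam lam).
Proof.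
exists (fun k => ball 0 k%:R `*` ball 0 k%:R).
  apply/esym/seteqP; split => // -[x y] _.
  exists (Num.trunc (Num.max `|x| `|y|)).+1 => //; rewrite -ball_normE.
  have m0 : 0 <= Num.max `|x| `|y| by rewrite le_max normr_ge0.
  have /andP[_] := trunc_itv m0.
  by rewrite gt_max => /andP[? ?]; split; rewrite /ball_/= sub0r normrN.
have mb k : measurable (ball 0 k%:R : set (Rn R N)) by exact: measurable_ball_rV.
move=> k; split; first exact: measurableX.
rewrite product_measure1E// lte_mul_pinfty//; last exact: lebesgue_ball_lty.
by rewrite ge0_fin_numE// lebesgue_ball_lty.
Qed.

(** The product measure bundled with its sigma-finiteness, so that Tonelli's
    theorem and the layer cake formula apply to it. *)
Definition product_lebesgue : {sigma_finite_measure set (Rn R N * Rn R N)%type -> \bar R} :=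
  HB.pack (product_measure1 lam lam)
    (@Measure_isSigmaFinite.Build _ _ R (product_measure1 lam lam)
      product_lebesgue_sigma_finite).

(** Points at distance less than [r] from a given one form a set of measure at
    most [(2 r)^N]. *)
Lemma product_measure_near_diagonal (S : set (Rn R N * Rn R N)) (U : set (Rn R N)) (r : R) :
  0 <= r -> measurable S -> measurable U ->
  (forall z, S z -> U z.1 /\ enorm (z.1 - z.2) < r) ->
  ((lam \x lam) S <= ((2 * r) ^+ N)%:E * lam U)%E.
Proof.
move=> r0 mS mU SU.
have r2 : 0 <= (2 * r) ^+ N by rewrite exprn_ge0// mulr_ge0.
rewrite -integral_cst//=.
rewrite [leRHS]integral_mkcond /product_measure1/=.
apply: ge0_le_integral; [exact: measurableT| | | |].
- by move=> x _; exact: measure_ge0.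
- exact: measurable_fun_xsection.
- by apply/(measurable_restrictT _ mU)/measurable_funTS; exact: measurable_cst.
- move=> x _; rewrite patchE; case: ifPn => xU.
    apply: le_trans (lebesgue_ball_le x r0); apply: le_lebesgue_outer => y.
    by rewrite /xsection/= inE => /SU[_ /= /enorm_lt_ball].
  rewrite (_ : xsection S x = set0) ?measure0//.
  apply/seteqP; split => // y; rewrite /xsection/= inE => /SU[/= Ux _].
  by move: xU; rewrite notin_setE.
Qed.

Lemma lebesgue_bigsetU_le (F : 'I_N -> set 'rV[R]_N) :
  (lebesgue_outer (\big[setU/set0]_i F i) <= \sum_i lebesgue_outer (F i))%E.
Proof.
elim/big_ind2 : _ => [|x A y B xA yB|//]; first by rewrite lebesgue_outer0.
exact: (le_trans (outer_measureU2 (@lebesgue_outer R N) _ _) (leeD xA yB)).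
Qed.

(** The layer of width [h] along the two faces orthogonal to the [i]-th axis of
    the cube of centre [x] and half-side [r]. *)
Definition face_layer (x : 'rV[R]_N) (r h : R) (i : 'I_N) : set 'rV[R]_N :=
  box (x - const_mx r) (set_coord (x + const_mx r) i (x ord0 i - r + h)) `|`
  box (set_coord (x - const_mx r) i (x ord0 i + r - h)) (x + const_mx r).

Lemma box_volume_thin (x : 'rV[R]_N) (r h : R) i : 0 <= r -> 0 <= h ->
  box_volume (x - const_mx r) (set_coord (x + const_mx r) i (x ord0 i - r + h))
    = h * \prod_(j < N | j != i) (2 * r) /\
  box_volume (set_coord (x - const_mx r) i (x ord0 i + r - h)) (x + const_mx r)
    = h * \prod_(j < N | j != i) (2 * r).
Proof.
move=> r0 h0; rewrite /box_volume !(bigD1 (P := predT) i)//= !mxE eqxx.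
have -> : x ord0 i - r + h - (x ord0 i - r) = h by ring.
have -> : x ord0 i + r - (x ord0 i + r - h) = h by ring.
rewrite (max_r h0); split; congr (_ * _); apply: eq_bigr => j ji.
- rewrite !mxE (negbTE ji) (_ : _ - _ = 2 * r); last by ring.
  by rewrite max_r// mulr_ge0.
- rewrite !mxE (negbTE ji) (_ : _ - _ = 2 * r); last by ring.
  by rewrite max_r// mulr_ge0.
Qed.

(** Balls are cubes here: a point of the cube that is [h]-close to the
    complement is [h]-close to one of the faces. *)
Lemma ball_boundary_layer (x y z : 'rV[R]_N) (r h : R) :
  0 < r -> ball x r y -> ~ ball x r z -> enorm (y - z) < h ->
  exists i, face_layer x r h i y.
Proof.
move=> r0 xy xz yz.
have /existsNP[i /negP] : ~ forall i, `|x ord0 i - z ord0 i| < r.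
  by move=> H; apply: xz; apply/ball_rV_coord.
rewrite -leNgt => ri; exists i.
have := le_lt_trans (coord_le_enorm (y - z) i) yz; rewrite !mxE => yzi.
have /boxP yb := ball_sub_center_box xy.
have [yx|yx] := leP (y ord0 i) (x ord0 i - r + h); [left|right]; apply/boxP => j.
  have := yb j; rewrite /center_box !mxE => /andP[-> yj]/=.
  by case: eqP => [->|].
have := yb j; rewrite /center_box !mxE => /andP[yj ->]; rewrite andbT.
case: eqP => [->|//].
have := yb i; rewrite !mxE => /andP[? ?].
move: yzi ri; rewrite ltr_norml ler_normr => /andP[? ?] /orP[?|?]; lra.
Qed.

Lemma measurable_box (a b : 'rV[R]_N) : measurable (box a b : set (Rn R N)).
Proof.
rewrite (_ : box a b = \bigcap_(i in [set: 'I_N])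
    ([set x : Rn R N | x ord0 i <= b ord0 i] `\` [set x : Rn R N | x ord0 i <= a ord0 i])).
  apply: fin_bigcap_measurable => // i _.
  by apply: measurableD; exact: measurable_halfspace.
apply/seteqP; split => x.
  move=> /boxP xab i _; have /andP[ax xb] := xab i.
  by split => //=; apply/negP; rewrite -ltNge.
move=> xab; apply/boxP => i; have [/= -> /negP] := xab i I.
by rewrite -ltNge => ->.
Qed.

Lemma measurable_face_layers (x : 'rV[R]_N) (r h : R) :
  measurable (\big[setU/set0]_i face_layer x r h i : set (Rn R N)).
Proof.
by apply: bigsetU_measurable => i _; apply: measurableU; exact: measurable_box.
Qed.

Lemma lebesgue_face_layers (x : 'rV[R]_N) (r h : R) : 0 <= r -> 0 <= h ->
  (lam (\big[setU/set0]_i face_layer x r h i) <=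
    (h * \sum_(i < N) 2 * \prod_(j < N | j != i) (2 * r))%:E)%E.
Proof.
move=> r0 h0; apply: (le_trans (lebesgue_bigsetU_le _)).
rewrite mulr_sumr -sumEFin; apply: lee_sum => i _.
apply: (le_trans (outer_measureU2 (@lebesgue_outer R N) _ _)).
rewrite (_ : h * _ = h * \prod_(j < N | j != i) (2 * r) +
  h * \prod_(j < N | j != i) (2 * r)); last by ring.
rewrite EFinD.
have [e1 e2] := box_volume_thin x i r0 h0.
by apply: leeD; apply: (le_trans (lebesgue_outer_box _ _)); rewrite ?e1 ?e2.
Qed.

Lemma powR_layer_split (s r : R) : 0 < r ->
  r `^ (- (N%:R + s) - 1) * r ^+ N = r `^ (- s - 1).
Proof.
move=> r0; rewrite -powR_mulrn ?(ltW r0)// -powRD; last by rewrite (gt_eqF r0) implybT.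
by congr (_ `^ _); ring.
Qed.

(** By the layer cake formula it suffices to bound the measure [h t] of the
    pairs that cross the boundary at distance less than [t].  It is of order
    [t^N] because the ball is bounded, and also of order [t^(N+1)] because the
    first point must lie in a boundary layer of width [t].  Against the weight [t^(-N-s-1)] this
    leaves [t^(-s)] near 0 and [t^(-s-1)] at infinity, integrable because
    [0 < s < 1]. *)
Lemma frac_measure_ball_lty (s : R) (x : 'rV[R]_N) (r : R) : 0 < s < 1 -> 0 < r ->
  (frac_measure s ((ball x r : set (Rn R N)) `*` ~` ball x r) < +oo)%E.
Proof.
move=> /andP[s0 s1] r0.
set Q : set (Rn R N) := ball x r.
have mQ : measurable Q by exact: measurable_ball_rV.
pose B := Q `*` ~` Q.
have mB : measurable B by apply: measurableX => //; exact: measurableC.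
pose g (z : Rn R N * Rn R N) := enorm (z.1 - z.2).
have mg : measurable_fun setT g by exact: measurable_enorm.
pose p := N%:R + s.
have p0 : 0 < p by rewrite ltr_wpDl.
pose C0 := (2 * r) ^+ N.
pose C1 := \sum_(i < N) 2 * \prod_(j < N | j != i) (2 * r).
pose h t := (lam \x lam)%E (B `&` [set z | g z < t]).
have mBt t : measurable (B `&` [set z | g z < t]) by exact: measurable_sublevel.
have h_le0 t : t <= 0 -> h t = 0%E.
  move=> t0; rewrite /h (_ : _ `&` _ = set0) ?measure0//.
  apply/seteqP; split => // z [_ /=] /lt_le_trans /(_ t0).
  by rewrite ltNge enorm_ge0.
have h_le_far t : 0 < t -> (h t <= ((2 * t) ^+ N * C0)%:E)%E.
  move=> t0; rewrite EFinM.
  apply: (le_trans (@product_measure_near_diagonal _ Q _ (ltW t0) (mBt t) mQ _)).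
    by move=> z [[Qz _] /= gz]; split.
  apply: lee_wpmul2l; first by rewrite lee_fin exprn_ge0// mulr_ge0 ?ltW.
  exact: lebesgue_ball_le (ltW r0).
have h_le_near t : 0 < t -> (h t <= ((2 * t) ^+ N * (t * C1))%:E)%E.
  move=> t0; rewrite (EFinM ((2 * t) ^+ N)).
  apply: (le_trans (@product_measure_near_diagonal _ _ _ (ltW t0) (mBt t)
    (measurable_face_layers x r t) _)).
    move=> z [[Qz nQz] /= gz]; split => //.
    have [i zi] := ball_boundary_layer r0 Qz nQz gz.
    by rewrite (bigD1 i)//=; left.
  apply: lee_wpmul2l; first by rewrite lee_fin exprn_ge0// mulr_ge0 ?ltW.
  exact: lebesgue_face_layers (ltW r0) (ltW t0).
(* [f1] and [f2] dominate the layer cake integrand on ]0, 1] and ]1, +oo[ *)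
pose f1 (t : R) := ((p * 2 ^+ N * C1)%:E * (t `^ (- s))%:E)%E.
pose f2 (t : R) := ((p * 2 ^+ N * C0 / s)%:E * (s * t `^ (- s - 1))%:E)%E.
have C1_ge0 : 0 <= C1.
  apply: sumr_ge0 => i _; rewrite mulr_ge0//; apply: prodr_ge0 => j _.
  by rewrite mulr_ge0 ?ltW.
have C0_ge0 : 0 <= C0 by rewrite exprn_ge0// mulr_ge0 ?ltW.
have f1_ge0 t : (0 <= f1 t)%E.
  by rewrite mule_ge0// lee_fin ?powR_ge0// !mulr_ge0 ?exprn_ge0 ?(ltW p0).
have f2_ge0 t : (0 <= f2 t)%E.
  by rewrite mule_ge0// lee_fin ?mulr_ge0 ?powR_ge0 ?C0_ge0 ?exprn_ge0 ?invr_ge0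
    ?(ltW p0) ?(ltW s0).
have mf1 : measurable_fun setT f1.
  by apply/measurable_funeM/measurable_EFinP; exact: measurable_powR.
have mf2 : measurable_fun setT f2.
  apply/measurable_funeM/measurable_EFinP; apply: measurable_funM.
    exact: measurable_cst.
  exact: measurable_powR.
pose I1 : set (measurableTypeR R) := `]0, 1]%classic.
pose I2 : set (measurableTypeR R) := `]1, +oo[%classic.
have mI1 : measurable I1 by exact: measurable_itv.
have mI2 : measurable I2 by exact: measurable_itv.
rewrite [ltLHS](_ : _ = \int[lam \x lam]_(z in B) (g z `^ (- p))%:E)%E; last first.
  by apply: eq_integral => z _; rewrite frac_kernelE.
rewrite [ltLHS](_ : _ = \int[mu]_t ((p * t `^ (- p - 1))%:E * h t))%E; last first.
  have g_gt0 z : B z -> 0 < g z.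
    move=> [Qz nQz]; apply: enorm_gt0; rewrite subr_eq0.
    by apply/eqP => zz; apply: nQz; rewrite -zz.
  exact: (@layer_cake _ _ R product_lebesgue B g p p0 mB mg g_gt0).
apply: (@le_lt_trans _ _ (\int[mu]_t ((f1 \_ I1) t + (f2 \_ I2) t))%E).
  apply: ge0_le_integral; [exact: measurableT| | | |].
  - move=> t _; apply: mule_ge0; last exact: measure_ge0.
    by rewrite lee_fin mulr_ge0 ?powR_ge0 ?ltW.
  - exact: (@measurable_layer _ _ R product_lebesgue).
  - apply: emeasurable_funD; [exact/(measurable_restrictT _ mI1)/measurable_funTS|
      exact/(measurable_restrictT _ mI2)/measurable_funTS].
  move=> t _; have [t0|t0] := leP t 0.
    rewrite -/(h t) h_le0// mule0 adde_ge0// patchE; case: ifP => //.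
  rewrite -/(h t); have w0 : (0 <= (p * t `^ (- p - 1))%:E)%E.
    by rewrite lee_fin mulr_ge0 ?powR_ge0 ?ltW.
  rewrite !patchE !mem_setE /I1 /I2 !in_itv/= t0/= andbT.
  have [t1|t1] := leP t 1.
    rewrite adde0; apply: (le_trans (lee_wpmul2l w0 (h_le_near t t0))).
    rewrite /f1 -!EFinM lee_fin exprMn.
    rewrite [leLHS](_ : _ = p * 2 ^+ N * C1 * (t * (t `^ (- p - 1) * t ^+ N))); last by ring.
    rewrite powR_layer_split//.
    have -> : t * t `^ (- s - 1) = t `^ (- s); last by [].
    rewrite -{1}(powRr1 (ltW t0)) -powRD; last by rewrite (gt_eqF t0) implybT.
    by rewrite addrC subrK.
  rewrite add0e; apply: (le_trans (lee_wpmul2l w0 (h_le_far t t0))).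
  rewrite /f2 -!EFinM lee_fin exprMn.
  rewrite [leLHS](_ : _ = p * 2 ^+ N * C0 * (t `^ (- p - 1) * t ^+ N)); last by ring.
  rewrite powR_layer_split// [leRHS](_ : _ = p * 2 ^+ N * C0 * t `^ (- s - 1))//.
  by field; rewrite gt_eqF.
rewrite ge0_integralD; [|exact: measurableT| | | |]; last 4 first.
- by move=> t _; rewrite patchE; case: ifP.
- exact/(measurable_restrictT _ mI1)/measurable_funTS.
- by move=> t _; rewrite patchE; case: ifP.
- exact/(measurable_restrictT _ mI2)/measurable_funTS.
rewrite -!integral_mkcond; apply: lte_add_pinfty.
  rewrite ge0_integralZl_EFin; [|exact: mI1| | |]; last 3 first.
  - by move=> t _; rewrite lee_fin powR_ge0.
  - by apply/measurable_funTS/measurable_EFinP; exact: measurable_powR.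
  - by rewrite !mulr_ge0 ?exprn_ge0 ?(ltW p0).
  rewrite lte_mul_pinfty ?lee_fin ?mulr_ge0 ?exprn_ge0 ?(ltW p0)//.
  by apply: (le_lt_trans (integral_powR_near0 _)); rewrite ?s0 ?ltry.
rewrite ge0_integralZl_EFin; [|exact: mI2| | |]; last 3 first.
- by move=> t _; rewrite lee_fin mulr_ge0 ?powR_ge0 ?ltW.
- apply/measurable_funTS/measurable_EFinP; apply: measurable_funM.
    exact: measurable_cst.
  exact: measurable_powR.
- by rewrite !mulr_ge0 ?C0_ge0 ?exprn_ge0 ?invr_ge0 ?(ltW p0) ?(ltW s0).
by rewrite integral_powR_tail// -EFinM ltry.
Qed.

(** The translate [D] of the ball by [2 r] in every coordinate is disjoint from
    [G], its measure is at least that of [G], and its points are at bounded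
    distance from those of [G], so the kernel is bounded below on [G * D]. *)
Lemma lebesgue_sqr_le_frac_measure (s r : R) : (0 < N)%N -> 0 < r -> 0 < N%:R + s ->
  exists2 C : R, 0 < C & forall G : set (Rn R N), measurable G -> G `<=` ball 0 r ->
    (lam G * lam G <= C%:E * frac_measure s (G `*` ~` G))%E.
Proof.
move=> N0 r0 p0.
pose a : 'rV[R]_N := const_mx (2 * r).
(* [M] bounds the distance between a point of [G] and a point of [D], whose
   coordinates differ by at most [4 r] *)
pose M := Num.sqrt (\sum_(i < N) (4 * r) ^+ 2).
have M0 : 0 < M.
  rewrite sqrtr_gt0 sumr_const card_ord pmulrn_lgt0// exprn_gt0// mulr_gt0//.
exists (M `^ (N%:R + s)); first exact: powR_gt0.
move=> G mG Gr; pose D : set (Rn R N) := ball a r.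
have mD : measurable D by exact: measurable_ball_rV.
have GD : (lam G <= lam D)%E.
  apply: le_trans (le_lebesgue_outer Gr) _.
  apply: le_trans (lebesgue_outer_translate _ (- a)).
  apply: le_lebesgue_outer => x /ball_rV_coord[_ xr] /=; apply/ball_rV_coord.
  by split => // i; have := xr i; rewrite !mxE; congr (`|_| < _); ring.
have DG : D `<=` ~` G.
  move=> x /ball_rV_coord[_ Dx] /Gr/ball_rV_coord[_ Gx].
  have := Dx (Ordinal N0); have := Gx (Ordinal N0); rewrite !mxE sub0r normrN.
  by rewrite !ltr_norml => /andP[? ?] /andP[? ?]; lra.
apply: (@le_trans _ _ (lam G * lam D)%E); first exact: lee_wpmul2l.
have kernel_ge (z : Rn R N * Rn R N) : (G `*` D) z ->
    (M `^ (N%:R + s))^-1 <= frac_kernel s z.1 z.2.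
  move=> [Gz Dz]; have zz : 0 < enorm (z.1 - z.2).
    apply: enorm_gt0; rewrite subr_eq0; apply/eqP => zz.
    by apply: (DG _ Dz); rewrite -zz.
  rewrite /frac_kernel lef_pV2 ?posrE ?powR_gt0//.
  apply: ge0_ler_powR; rewrite ?nnegrE ?(ltW p0) ?enorm_ge0 ?(ltW M0)//.
  rewrite ler_sqrt; last by apply: sumr_ge0 => i _; exact: sqr_ge0.
  apply: ler_sum => i _; rewrite -[leLHS]real_normK ?num_real//.
  rewrite lerXn2r ?nnegrE ?normr_ge0 ?mulr_ge0 ?(ltW r0)//.
  move: Gz => /Gr/ball_rV_coord[_ /(_ i)]; move: Dz => /ball_rV_coord[_ /(_ i)].
  rewrite !mxE sub0r normrN !ltr_norml ler_norml => /andP[? ?] /andP[? ?].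
  by apply/andP; split; lra.
have mGD : measurable (G `*` D) by exact: measurableX.
have le_nu : ((M `^ (N%:R + s))^-1%:E * (lam G * lam D) <= frac_measure s (G `*` ~` G))%E.
  apply: (@le_trans _ _ (frac_measure s (G `*` D))); last first.
    apply: le_measure; rewrite ?inE//.
      by apply: measurableX => //; exact: measurableC.
    by move=> z [Gz Dz]; split => //; exact: DG.
  rewrite -(product_measure1E lam lam mG mD) -(integral_cst _ mGD).
  apply: ge0_le_integral; [exact: mGD| | | |].
  - by move=> z _; rewrite lee_fin invr_ge0 powR_ge0.
  - exact: measurable_cst.
  - by apply: measurable_funTS; exact: measurable_frac_kernel.
  - by move=> z zGD; rewrite lee_fin; exact: kernel_ge.
by move: le_nu; rewrite lee_pdivrMl ?powR_gt0.
Qed.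

End ball_estimates.

(** * Coarea, and sets of capacity zero *)

Section coarea.
Context {R : realType} {n : nat}.
Local Notation lam := (@lebesgue_Rn R n).
Local Notation mu := (@lebesgue_measure R).

Lemma continuous_measurable_rV (v : 'rV[R]_n -> R) :
  continuous v -> measurable_fun [set: Rn R n] (v : Rn R n -> R).
Proof.
move=> cv.
apply: (measurability _ (RGenOInfty.measurableE R)) => _ [_ [c ->] <-].
rewrite setTI; apply: measurable_open_rV.
by move/continuousP : cv; apply; exact: rray_open.
Qed.

Lemma measurable_ltr_set d (T : measurableType d) (f g : T -> R) :
  measurable_fun setT f -> measurable_fun setT g -> measurable [set x | f x < g x].
Proof.
move=> mf mg; rewrite -[X in measurable X]setTI.
by have := measurable_fun_ltr mf mg measurableT (Y := [set true]); apply.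
Qed.

Lemma measurable_superlevel_Rn (v : Rn R n -> R) (t : R) :
  measurable_fun setT v -> measurable [set x | t <= v x].
Proof.
move=> mv; rewrite (_ : [set x | _] = v @^-1` `[t, +oo[); last first.
  by apply/seteqP; split => x /=; rewrite in_itv/= andbT.
by rewrite -[X in measurable X]setTI; exact: mv.
Qed.

(** For each pair of points the levels [t] that separate them form a set of
    length at most [|v x - v y|]; integrating the perimeters of the superlevel
    sets over [t] in (0, 1) therefore gives at most the seminorm of [v], and
    some level does not exceed the average. *)
Lemma coarea_level (s e : R) (v : Rn R n -> R) : 0 <= e -> measurable_fun setT v ->
  (gagliardo s v < e%:E)%E ->
  exists2 t, 0 < t < 1 &
    (frac_measure s ([set x | (t <= v x)%R] `*` ~` [set x | (t <= v x)%R]) <= e%:E)%E.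
Proof.
move=> e0 mv gv; apply: contrapT => no.
pose L t : set (Rn R n) := [set x | t <= v x].
have mL t : measurable (L t) by exact: measurable_superlevel_Rn.
have mLL t : measurable (L t `*` ~` L t) by apply: measurableX => //; exact: measurableC.
pose S : set (measurableTypeR R * (Rn R n * Rn R n)) :=
  [set z | [/\ 0 < z.1 < 1, z.1 <= v z.2.1 & v z.2.2 < z.1]].
have mS : measurable S.
  rewrite (_ : S = [set z | 0 < z.1] `&` [set z | z.1 < 1] `&`
      ~` [set z | v z.2.1 < z.1] `&` [set z | v z.2.2 < z.1]); last first.
    apply/seteqP; split => z; rewrite /S/=.
      by move=> [/andP[? ?] ? ?]; split => //; split => //; apply/negP; rewrite -leNgt.
    by move=> [[[-> ->] /negP]]; rewrite -leNgt => ? ?; split.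
  have mv1 : measurable_fun setT
      (fun z : measurableTypeR R * (Rn R n * Rn R n) => v z.2.1).
    exact: measurableT_comp mv (measurableT_comp measurable_fst measurable_snd).
  have mv2 : measurable_fun setT
      (fun z : measurableTypeR R * (Rn R n * Rn R n) => v z.2.2).
    exact: measurableT_comp mv (measurableT_comp measurable_snd measurable_snd).
  apply: measurableI; last by apply: measurable_ltr_set => //; exact: measurable_fst.
  apply: measurableI.
    apply: measurableI; apply: measurable_ltr_set;
      by [exact: measurable_cst|exact: measurable_fst].
  by apply: measurableC; apply: measurable_ltr_set => //; exact: measurable_fst.
pose f (z : measurableTypeR R * (Rn R n * Rn R n)) := (frac_kernel s z.2.1 z.2.2)%:E.
have mf : measurable_fun setT f.
  exact: (measurableT_comp (@measurable_frac_kernel R n s) measurable_snd).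
have f0 z : (0 <= f z)%E by rewrite lee_fin frac_kernel_ge0.
have xS t : xsection S t = if (0 < t < 1) then L t `*` ~` L t else set0.
  apply/seteqP; split => [[x y]|[x y]]; rewrite /xsection/= inE /S/=.
    by move=> [-> tx ty]; split => //=; apply/negP; rewrite -ltNge.
  by case: ifPn => // _ [tx /= /negP]; rewrite -ltNge => ty.
pose I01 : set (measurableTypeR R) := `]0, 1[%classic.
have mI01 : measurable I01 by exact: measurable_itv.
have lower : (e%:E <= \int[mu]_t \int[@product_lebesgue R n]_(z in xsection S t) f (t, z))%E.
  rewrite [leLHS](_ : _ = \int[mu]_t (cst e%:E \_ I01) t)%E; last first.
    have muI : mu `]0%R, 1%R[%classic = 1%E.
      by rewrite lebesgue_measure_itv/= lte_fin ltr01 oppr0 adde0.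
    by rewrite -integral_mkcond (integral_cst _ mI01) (_ : _ I01 = 1%E) ?mule1.
  apply: ge0_le_integral; [exact: measurableT| | | |].
  - by move=> t _; rewrite patchE; case: ifP => //; rewrite lee_fin.
  - by apply/(measurable_restrictT _ mI01)/measurable_funTS; exact: measurable_cst.
  - exact: (measurable_integral_xsection _ mf f0 mS).
  move=> t _; rewrite xS patchE mem_setE /I01 in_itv/=; case: ifP => [t01|_].
    have [//|le] := leP (e%:E)%E (\int[@product_lebesgue R n]_(z in L t `*` ~` L t) f (t, z))%E.
    by exfalso; apply: no; exists t => //; exact: ltW le.
  by rewrite integral_set0.
have upper : (\int[mu]_t \int[@product_lebesgue R n]_(z in xsection S t) f (t, z) <= gagliardo s v)%E.
  rewrite -(integral_xsection _ _ mf f0 mS) (integral_ysection _ _ mf f0 mS).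
  pose F (z : Rn R n * Rn R n) := (`|v z.1 - v z.2| * frac_kernel s z.1 z.2)%:E.
  have mF : measurable_fun setT F.
    apply/measurable_EFinP; apply: measurable_funM.
      apply: measurableT_comp => //; apply: measurable_funB.
        exact: measurableT_comp mv measurable_fst.
      exact: measurableT_comp mv measurable_snd.
    by apply/measurable_EFinP; exact: measurable_frac_kernel.
  have F0 z : (0 <= F z)%E by rewrite lee_fin mulr_ge0 ?frac_kernel_ge0.
  rewrite [leRHS](_ : _ = \int[@product_lebesgue R n]_z F z)%E; last first.
    rewrite -[X in (\int[_]_(z in X) _)%E]setXTT.
    exact/esym/(integral_rectangle _ _ mF F0 measurableT measurableT).
  apply: ge0_le_integral; [exact: measurableT| | |exact: mF|].
  - by move=> z _; apply: integral_ge0 => t _; exact: f0.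
  - exact: (measurable_integral_ysection _ mf f0 mS).
  move=> z _; rewrite /f/= (integral_cst _ (measurable_ysection _ mS)).
  rewrite /F EFinM muleC; apply: lee_wpmul2r; first by rewrite lee_fin frac_kernel_ge0.
  apply: (@le_trans _ _ (mu `]v z.2, v z.1])).
    apply: le_measure; rewrite ?inE; [exact: measurable_ysection|exact: measurable_itv|].
    move=> t; rewrite /ysection/= inE /S/= in_itv/= => -[_ tv vt].
    by rewrite vt tv.
  rewrite lebesgue_measure_itv/= lte_fin; case: ifPn => _; last by rewrite lee_fin.
  by rewrite -EFinD lee_fin ler_norm.
by have := le_lt_trans (le_trans lower upper) gv; rewrite ltxx.
Qed.

End coarea.

Lemma compact_sub_ball {R : realType} {n : nat} (K : set 'rV[R]_n) :
  compact K -> exists2 r : R, 0 < r & K `<=` ball 0 r.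
Proof.
move=> compK; have [M [Mreal KM]] := compact_bounded compK.
exists (Num.max 1 (M + 2)); first by rewrite lt_max ltr01.
move=> x Kx; rewrite -ball_normE/= sub0r normrN.
have /le_lt_trans : `|x| <= M + 1 by apply: KM => //; rewrite ltrDl.
by apply; rewrite lt_max ltrD2l ltr1n orbT.
Qed.

(** A superlevel set of a test function with small seminorm.  The level is
    below 1, which leaves room for an open set between [K] and [G]. *)
Lemma capacity_zero_level_set {R : realType} {n : nat} (s : R) (K : set 'rV[R]_n) :
  (0 < n)%N -> 0 < s -> compact K -> capacity_zero s K -> forall e, 0 < e ->
  exists (G N : set 'rV[R]_n), [/\ closed G, open N, K `<=` N, N `<=` G &
    (frac_measure s ((G : set (Rn R n)) `*` ~` G) <= e%:E)%E /\ (lebesgue_Rn G <= e%:E)%E].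
Proof.
move=> n0 s0 compK capK.
have [r r0 Kr] := compact_sub_ball compK.
have p0 : 0 < n%:R + s by rewrite ltr_wpDl.
have [C C0 CG] := lebesgue_sqr_le_frac_measure n0 r0 p0.
move=> e e0.
pose d := Num.min e (e ^+ 2 / C).
have d0 : 0 < d by rewrite lt_min e0 divr_gt0// exprn_gt0.
pose U : set 'rV[R]_n := ball 0 r.
have openU : open U by exact: ball_open.
have := capK _ openU; rewrite /cap => cap0.
have : (ereal_inf [set cap_open s G U | G in
   [set G | [/\ open G, K `&` U `<=` G & G `<=` U]]] < d%:E)%E.
  by rewrite cap0 lte_fin.
move=> /ereal_inf_lt[_ [G0 [openG0 KG0 G0U] <-] capG0].
have : (cap_compact s K U < d%:E)%E.
  apply: le_lt_trans capG0; apply: ereal_sup_ubound; exists K => //; split => //.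
  by move=> x Kx; apply: KG0; split => //; exact: Kr.
move=> /ereal_inf_lt[_ [v [[smoothv compv suppv] Kv] <-] gv].
have contv : continuous v by have [] := smoothv [::].
have mv := continuous_measurable_rV contv.
have [t /andP[t0 t1] nut] := coarea_level (ltW d0) mv gv.
have GU : [set x | t <= v x] `<=` U.
  move=> x /= tx; apply: suppv; apply: subset_closure => /=.
  by rewrite gt_eqF// (lt_le_trans t0).
exists [set x | t <= v x], [set x | t < v x]; split.
- rewrite (_ : [set x | _] = v @^-1` [set r | t <= r])//.
  by apply: closed_comp => [x _|]; [exact: contv|exact: closed_ge].
- rewrite (_ : [set x | _] = v @^-1` [set r | t < r])//.
  by apply: open_comp => [x _|]; [exact: contv|exact: open_gt].
- by move=> x /Kv /= vx; apply: lt_le_trans vx.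
- by move=> x /= /ltW.
split; first by apply: (le_trans nut); rewrite lee_fin ge_min lexx.
have mG := measurable_superlevel_Rn t mv.
have := CG _ mG GU; set a := lebesgue_Rn _ => aa.
have a0 : (0 <= a)%E by exact: measure_ge0.
have {aa} : (a * a <= (e ^+ 2)%:E)%E.
  apply: (le_trans aa).
  apply: (@le_trans _ _ (C%:E * d%:E)%E).
    by apply: lee_wpmul2l nut; rewrite lee_fin ltW.
  rewrite -EFinM lee_fin mulrC -ler_pdivlMr// ge_min lexx orbT//.
case: a a0 => [a| |//]; last by rewrite mulyy leye_eq.
rewrite lee_fin -EFinM !lee_fin -expr2 => a0.
by rewrite ler_sqr ?nnegrE// ltW.
Qed.

(** * Removable sets for s-minimal sets *)

Section removability.
Context {R : realType} {N : nat}.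
Variable s : R.
Local Notation lam := (@lebesgue_Rn R N).
Local Notation nu := (@frac_measure R N s).
Implicit Types (A E F C O : set (Rn R N)).

(** The pairs of points counted by the s-perimeter of [A] in [O]. *)
Definition crossing A O : set (Rn R N * Rn R N) :=
  [set z | [/\ A z.1, ~ A z.2 & O z.1 \/ O z.2]].

Lemma crossingE A O :
  crossing A O = (A `&` O) `*` ~` A `|` (A `\` O) `*` (O `\` A).
Proof.
apply/seteqP; split => [[x y] [/= Ax nAy Oxy]|[x y] [[[/= Ax Ox] nAy]|[[/= Ax nOx] [Oy nAy]]]].
- have [Ox|nOx] := pselect (O x); first by left.
  by right; split => //=; split => //; case: Oxy.
- by split => //; left.
- by split => //; right.
Qed.

Lemma measurable_crossing A O : measurable A -> measurable O -> measurable (crossing A O).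
Proof.
move=> mA mO; rewrite crossingE; apply: measurableU; apply: measurableX.
- exact: measurableI.
- exact: measurableC.
- exact: measurableD.
- exact: measurableD.
Qed.

Lemma s_perimeterE A O : measurable A -> measurable O ->
  s_perimeter s A O = nu (crossing A O).
Proof.
move=> mA mO; have mAc : measurable (~` A) by exact: measurableC.
have mAO : measurable (A `&` O) by exact: measurableI.
have mAnO : measurable (A `\` O) by exact: measurableD.
have mOA : measurable (O `\` A) by exact: measurableD.
rewrite /s_perimeter (interactionE s mAO mAc) (interactionE s mAnO mOA).
rewrite crossingE; apply/esym/(@measureU _ _ _ (frac_measure s)).
- exact: measurableX.
- exact: measurableX.
- by apply/seteqP; split => // -[x y] [[[/= _ Ox] _] [[/= _ nOx] _]].
Qed.

Lemma le_s_perimeter A O O' : measurable A -> measurable O -> measurable O' ->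
  O `<=` O' -> (s_perimeter s A O <= s_perimeter s A O')%E.
Proof.
move=> mA mO mO' OO'; rewrite !s_perimeterE//.
apply: (@le_measure _ _ _ (frac_measure s)); rewrite ?inE;
  [exact: measurable_crossing|exact: measurable_crossing|].
by move=> z [Az nAz [Oz|Oz]]; split => //; [left|right]; exact: OO'.
Qed.

(** The patched set is [F] outside [C] and [E] inside; outside [O] the two agree.
    So a pair that crosses it in [O \ C] crosses [F] in [O], unless one of its
    points lies in [C & O] and the other one outside [C]. *)
Lemma le_perimeter_patch E F O C :
  measurable E -> measurable F -> measurable O -> measurable C ->
  F `\` O = E `\` O ->
  (s_perimeter s ((F `\` C) `|` (E `&` C)) (O `\` C) <=
    s_perimeter s F O + (nu ((C `&` O) `*` ~` C) + nu ((C `&` O) `*` ~` C)))%E.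
Proof.
move=> mE mF mO mC FE.
have FEO x : ~ O x -> F x <-> E x.
  move=> nOx; have := congr1 (fun A : set _ => A x) FE; rewrite /setD/= => e.
  split=> [Fx|Ex]; first by have [] : E x /\ ~ O x by rewrite -e.
  by have [] : F x /\ ~ O x by rewrite e.
set H := _ `|` _.
have mH : measurable H by apply: measurableU; [exact: measurableD|exact: measurableI].
have mOC : measurable (O `\` C) by exact: measurableD.
have mCO : measurable (C `&` O) by exact: measurableI.
have mCc : measurable (~` C) by exact: measurableC.
have mB1 : measurable ((C `&` O) `*` ~` C) by exact: measurableX.
have mB2 : measurable (~` C `*` (C `&` O)) by exact: measurableX.
rewrite (s_perimeterE mH mOC) (s_perimeterE mF mO).
rewrite {2}(frac_measure_swap s mCO mCc).
have mFO := measurable_crossing mF mO.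
apply: (@le_trans _ _ (nu (crossing F O `|` ((C `&` O) `*` ~` C `|` ~` C `*` (C `&` O))))).
  apply: (@le_measure _ _ _ (frac_measure s)); rewrite ?inE.
  - exact: measurable_crossing.
  - by apply: measurableU => //; exact: measurableU.
  move=> [x y] [/= Hx nHy Oxy].
  have [Cx|nCx] := pselect (C x); have [Cy|nCy] := pselect (C y).
  - by case: Oxy => -[].
  - have Ex : E x by case: Hx => -[].
    have nFy : ~ F y by move=> Fy; apply: nHy; left.
    have [Ox|nOx] := pselect (O x); first by right; left.
    left; split => //=; first exact/(FEO _ nOx).
    by case: Oxy => -[Oz _]; [left|right].
  - have Fx : F x by case: Hx => -[].
    have nEy : ~ E y by move=> Ey; apply: nHy; right.
    have [Oy|nOy] := pselect (O y); first by right; right.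
    left; split => //=; first by move/(FEO _ nOy).
    by case: Oxy => -[Oz _]; [left|right].
  - left; split => /=; first by case: Hx => -[].
      by move=> Fy; apply: nHy; left.
    by case: Oxy => -[Oz _]; [left|right].
apply: (le_trans (measureU2 (frac_measure s) mFO _)); first exact: measurableU.
by apply: leeD2l; exact: (measureU2 (frac_measure s) mB1 mB2).
Qed.

Lemma frac_measure_null (Z : set (Rn R N)) : measurable Z -> lam Z = 0%E ->
  (nu (Z `*` setT) <= 0)%E /\ (nu (setT `*` Z) <= 0)%E.
Proof.
move=> mZ Z0; rewrite (frac_measure_swap s measurableT mZ).
suff -> : nu (Z `*` setT) = 0%E by rewrite lexx.
rewrite -(interactionE s mZ measurableT); apply: null_set_integral => //.
by apply/measurable_funTS; exact: measurable_potential.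
Qed.

(** Minimality in [O \ C k] bounds the perimeter of [E] there by that of [F] in
    [O] plus [2^-k].  The pairs that cross [E] in [O] are, up to pairs with a
    point in the null set of those lying in infinitely many [C k], the
    increasing union of the sets [D m] of pairs that cross [E] in [O \ C k]
    for every [k >= m], so continuity from below concludes. *)
Lemma s_perimeter_le_removable E F O (C : nat -> set (Rn R N)) :
  measurable E -> measurable F -> measurable O -> (forall k, measurable (C k)) ->
  (forall k, (lam (C k `&` O) <= (1 / (2 ^ k.+1)%:R)%:E)%E) ->
  (forall k, (nu ((C k `&` O) `*` ~` C k) <= (1 / (2 ^ k.+1)%:R)%:E)%E) ->
  (forall k, s_minimal s E (O `\` C k)) ->
  F `\` O = E `\` O -> (s_perimeter s E O <= s_perimeter s F O)%E.
Proof.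
move=> mE mF mO mC lamC nuC minE FE.
have perE k : (s_perimeter s E (O `\` C k) <= s_perimeter s F O + ((2 ^ k)%:R^-1)%:E)%E.
  have [_ _ /(_ ((F `\` C k) `|` (E `&` C k)))] := minE k.
  have mH : measurable ((F `\` C k) `|` (E `&` C k)).
    by apply: measurableU; [exact: measurableD|exact: measurableI].
  move=> /(_ mH) H.
  apply: (le_trans (H _)).
    apply/seteqP; split => x.
      move=> [[[Fx nCx]|[Ex Cx]] nOCx].
        have nOx : ~ O x by move=> Ox; exact: nOCx.
        by have [] : (E `\` O) x by rewrite -FE.
      by split.
    move=> [Ex nOCx]; split => //.
    have [Cx|nCx] := pselect (C k x); [by right|left; split => //].
    have nOx : ~ O x by move=> Ox; exact: nOCx.
    by have [] : (F `\` O) x by rewrite FE.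
  apply: (le_trans (le_perimeter_patch mE mF mO (mC k) FE)).
  apply: leeD2l; apply: (le_trans (leeD (nuC k) (nuC k))).
  rewrite -EFinD lee_fin expnS natrM.
  have : (2 ^ k)%:R != 0 :> R by rewrite pnatr_eq0 expn_eq0.
  move: (2 ^ k)%:R => a a0; rewrite [leLHS](_ : _ = a^-1)//.
  by field.
pose Z := lim_sup_set (fun k => C k `&` O).
have mCO k : measurable (C k `&` O) by exact: measurableI.
have mZ : measurable Z.
  apply: bigcapT_measurable => k; apply: bigcup_measurable => j _; exact: mCO.
have Z0 : lam Z = 0%E.
  apply: (lim_sup_set_cvg0 (mu := lam) mCO).
  apply: (@le_lt_trans _ _ 1%E); last by rewrite ltry.
  apply: le_trans (epsilon_trick0 xpredT ler01).
  by apply: lee_nneseries => [k _ _|k _]; [exact: measure_ge0|exact: lamC].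
pose D m := \bigcap_(k in [set k | (m <= k)%N]) crossing E (O `\` C k).
have mOC k : measurable (O `\` C k) by exact: measurableD.
have mD m : measurable (D m).
  apply: bigcap_measurable; first by exists m => /=.
  by move=> k _; exact: measurable_crossing.
have nuD m : (nu (D m) <= s_perimeter s F O)%E.
  apply/lee_addgt0Pr => e e0.
  (* some later [k] has [2^-k < e], by the crude bound [k < 2^k] *)
  have [k mk ke] : exists2 k, (m <= k)%N & (2 ^ k)%:R^-1 < e.
    have [k _ /(_ (maxn m k) (leq_maxr _ _)) ke] := near_infty_natSinv_lt (PosNum e0).
    exists (maxn m k); first exact: leq_maxl.
    apply: le_lt_trans ke; rewrite lef_pV2 ?posrE ?ltr0n ?expn_gt0// ler_nat.
    exact: ltn_expl.
  apply: (@le_trans _ _ (nu (crossing E (O `\` C k)))).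
    apply: (@le_measure _ _ _ (frac_measure s)); rewrite ?inE;
      [exact: mD|exact: measurable_crossing|].
    by move=> z /(_ k mk).
  rewrite -(s_perimeterE mE (mOC k)); apply: (le_trans (perE k)).
  by apply: leeD2l; rewrite lee_fin ltW.
have ndD : nondecreasing_seq D.
  move=> i j ij; apply/subsetPset => z Dz k /= jk; apply: Dz => /=.
  exact: leq_trans jk.
have mUD : measurable (\bigcup_m D m) by exact: bigcupT_measurable.
have nuUD : (nu (\bigcup_m D m) <= s_perimeter s F O)%E.
  have cvgD := @nondecreasing_cvg_mu _ _ _ (frac_measure s) D mD mUD ndD.
  rewrite -(cvg_lim _ cvgD)//; apply: lime_le; first exact: cvgP cvgD.
  by apply: nearW => m; exact: nuD.
have [nuZl nuZr] := frac_measure_null mZ Z0.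
have mZl : measurable (Z `*` [set: Rn R N]) by exact: measurableX.
have mZr : measurable ([set: Rn R N] `*` Z) by exact: measurableX.
rewrite (s_perimeterE mE mO).
apply: (@le_trans _ _ (nu (\bigcup_m D m `|` (Z `*` setT `|` setT `*` Z)))).
  apply: (@le_measure _ _ _ (frac_measure s)); rewrite ?inE.
  - exact: measurable_crossing.
  - by apply: measurableU => //; exact: measurableU.
  have far x : O x -> ~ Z x -> exists m, forall k, (m <= k)%N -> (O `\` C k) x.
    move=> Ox nZx; have /existsNP[m nm] : ~ forall m, exists2 k, (m <= k)%N & C k x.
      by move=> H; apply: nZx => m _; have [k mk Ck] := H m; exists k.
    exists m => k mk; split => // Ckx; apply: nm; by exists k.
  move=> [x y] [/= Ex nEy Oxy].
  have [Zx|nZx] := pselect (Z x); first by right; left.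
  have [Zy|nZy] := pselect (Z y); first by right; right.
  left; case: Oxy => [Ox|Oy].
    by have [m Hm] := far x Ox nZx; exists m => // k mk; split => //; left; exact: Hm.
  by have [m Hm] := far y Oy nZy; exists m => // k mk; split => //; right; exact: Hm.
apply: (le_trans (measureU2 (frac_measure s) mUD _)); first exact: measurableU.
rewrite -[leRHS]adde0; apply: leeD; first exact: nuUD.
apply: (le_trans (measureU2 (frac_measure s) mZl mZr)).
by apply: (le_trans (leeD nuZl nuZr)); rewrite adde0.
Qed.

Lemma frac_measure_setU_lty A B : measurable A -> measurable B ->
  (nu (A `*` ~` A) < +oo)%E -> (nu (B `*` ~` B) < +oo)%E ->
  (nu ((A `|` B) `*` ~` (A `|` B)) < +oo)%E.
Proof.
move=> mA mB fA fB.
have mAA : measurable (A `*` ~` A) by apply: measurableX => //; exact: measurableC.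
have mBB : measurable (B `*` ~` B) by apply: measurableX => //; exact: measurableC.
apply: (@le_lt_trans _ _ (nu (A `*` ~` A) + nu (B `*` ~` B))%E); last exact: lte_add_pinfty.
apply: (le_trans _ (measureU2 (frac_measure s) mAA mBB)).
apply: (@le_measure _ _ _ (frac_measure s)); rewrite ?inE.
- by apply: measurableX; [exact: measurableU|apply: measurableC; exact: measurableU].
- exact: measurableU.
- move=> [x y] [/= [Ax|Bx] nABy]; [left|right]; split => //= ABy; apply: nABy;
    by [left|right].
Qed.

End removability.

Section exhaustion.
Context {R : realType} {N : nat}.
Variable s : R.
Hypothesis s01 : 0 < s < 1.

(** A finite union of small balls; finite perimeter, like the three other
    properties, is stable under unions. *)
Lemma open_exhaustion_finite_perimeter (A W : set 'rV[R]_N) :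
  compact A -> open W -> A `<=` W -> exists O : set 'rV[R]_N,
    [/\ open O, A `<=` O, compact (closure O), closure O `<=` W &
      (frac_measure s ((O : set (Rn R N)) `*` ~` O) < +oo)%E].
Proof.
move=> compA openW AW.
pose good (O : set 'rV[R]_N) := [/\ open O, compact (closure O), closure O `<=` W &
  (frac_measure s ((O : set (Rn R N)) `*` ~` O) < +oo)%E].
have /choice[r r_good] : forall x, exists r : R, 0 < r /\ (A x -> good (ball x r)).
  move=> x; have [Ax|nAx] := pselect (A x); last by exists 1.
  have /nbhs_ballP[e /= e0 xW] : nbhs x W by apply: open_nbhs_nbhs; split => //; exact: AW.
  have e20 : 0 < e / 2 by rewrite divr_gt0.
  have clB : closure (ball x (e / 2)) `<=` ball x e by exact: subset_closure_half.
  exists (e / 2); split => // _; split.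
  - exact: ball_open.
  - apply: bounded_closed_compact; last exact: closed_closure.
    exists (`|x| + e); split; first exact: num_real.
    move=> M xM y /clB; rewrite -ball_normE/= => xy.
    rewrite (le_trans _ (ltW xM))// -[y](subrK x) (le_trans (ler_normD _ _))//.
    by rewrite addrC lerD2l distrC ltW.
  - by move=> y /clB; exact: xW.
  - exact: frac_measure_ball_lty.
have coverA : cover_compact A by rewrite -compact_cover.
have [||D DA AD] := coverA _ A (fun x => ball x (r x)).
- by move=> x _; apply: ball_open; have [] := r_good x.
- by move=> x Ax; exists x => //; apply: ballxx; have [] := r_good x.
exists (\big[setU/set0]_(x <- finmap.enum_fset D) ball x (r x)).
have goodU : good (\big[setU/set0]_(x <- finmap.enum_fset D) ball x (r x)).
  rewrite big_seq; elim/big_ind : _ => [|O1 O2|x /DA].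
  - split; [exact: open0|by rewrite closure0; exact: compact0|by rewrite closure0|].
    by rewrite set0X measure0 ltry.
  - move=> [op1 c1 W1 f1] [op2 c2 W2 f2]; split.
    + exact: openU.
    + by rewrite closureU; exact: compactU.
    + by rewrite closureU subUset.
    + by apply: frac_measure_setU_lty => //; exact: measurable_open_rV.
  - by rewrite inE => Ax; have [_] := r_good x; apply.
have [? ? ? ?] := goodU; split => //.
by move=> x /AD[y /= yD xy]; rewrite -bigcup_fset; exists y.
Qed.

End exhaustion.

Unset Implicit Arguments.
Set Strict Implicit.
Set Printing Implicit Defensive.

Theorem mainTheorem2 (R : realType) (n : nat) (s : R)
    (n_gt0 : (0 < n)%N) (s_gt0 : 0 < s) (s_lt1 : s < 1)
    (Omega K : set 'rV[R]_n) (openOmega : open Omega) (compactK : compact K)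
    (KOmega : K `<=` Omega) (capK : capacity_zero s K)
    (E : set 'rV[R]_(n + 1)) :
  nonlocal_minimal_graph s (Omega `\` K) E -> nonlocal_minimal_graph s Omega E.
Proof.
move=> [minE graphE]; split; last exact: graphE.
have p0 : 0 < n%:R + s by rewrite ltr_wpDl.
have s01 : 0 < s < 1 by rewrite s_gt0.
(* minimality in the empty set still records that [E] is measurable *)
have mE : measurable (E : set (Rn R (n + 1))).
  have [] : s_minimal s E set0; last by [].
  by apply: minE; rewrite ?closure0; [exact: open0|exact: compact0|].
have le_per (O : set 'rV[R]_(n + 1)) (F : set 'rV[R]_(n + 1)) :
    open O -> compact (closure O) -> closure O `<=` cylinder Omega ->
    measurable (F : set (Rn R (n + 1))) -> F `\` O = E `\` O ->
    (s_perimeter s E O <= s_perimeter s F O)%E.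
  move=> openO compO OOmega mF FE.
  have [T T0 OT] : exists2 T : R, 0 < T & O `<=` slab (- T) T.
    have [T T0 OT] := compact_sub_ball compO.
    exists T => // X /subset_closure/OT/ball_rV_coord[_ /(_ (rshift n ord0))].
    by rewrite /slab/= !mxE sub0r normrN ltr_norml => /andP[-> /ltW].
  (* dividing by [c] absorbs the constants of both smallness estimates for the
     cylinders inside the slab that contains [O] *)
  pose c := 1 + 2 * T + 4 * T * ((n + 1)%:R + s) / (n%:R + s).
  have q0 : 0 <= 4 * T * ((n + 1)%:R + s) / (n%:R + s).
    by rewrite !mulr_ge0 ?invr_ge0 ?(ltW p0) ?(ltW T0)// addr_ge0// ltW.
  have c0 : 0 < c by rewrite ltr_wpDr// ltr_wpDr// mulr_ge0 ?ltW.
  pose e k : R := 1 / (2 ^ k.+1)%:R.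
  have e0 k : 0 < e k by rewrite divr_gt0// ltr0n expn_gt0.
  have /choice[GN GNP] : forall k, exists GN : set 'rV[R]_n * set 'rV[R]_n,
      [/\ closed GN.1, open GN.2, K `<=` GN.2, GN.2 `<=` GN.1 &
        (frac_measure s ((GN.1 : set (Rn R n)) `*` ~` GN.1) <= (e k / c)%:E)%E /\
        (lebesgue_Rn GN.1 <= (e k / c)%:E)%E].
    move=> k; have [] := capacity_zero_level_set n_gt0 s_gt0 compactK capK (divr_gt0 (e0 k) c0).
    by move=> G [N GN]; exists (G, N).
  have mG k : measurable ((GN k).1 : set (Rn R n)).
    have [clG _ _ _ _] := GNP k.
    by rewrite -[X in measurable X]setCK; apply/measurableC/measurable_open_rV/closed_openC.
  have mO : measurable (O : set (Rn R (n + 1))) by exact: measurable_open_rV.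
  pose C k : set (Rn R (n + 1)) := cylinder (GN k).1.
  have mC k : measurable (C k) by exact: measurable_cylinder.
  have small (a : R) k : 0 <= a -> a <= c -> (a%:E * (e k / c)%:E <= (e k)%:E)%E.
    by move=> a0 ac; rewrite -EFinM lee_fin mulrCA ler_piMr ?(ltW (e0 k))// ler_pdivrMr// mul1r.
  have msC k : measurable (C k `&` slab (- T) T).
    by apply: measurableI => //; exact: measurable_slab.
  apply: (@s_perimeter_le_removable _ _ s E F O C mE mF mO mC) => //.
  - move=> k; have [_ _ _ _ [_ lamG]] := GNP k.
    have sub : C k `&` O `<=` cylinder (GN k).1 `&` slab (- T) T by apply: setIS.
    apply: (le_trans (le_lebesgue_outer sub)).
    apply: (le_trans (lebesgue_outer_cylinder_slab _ _ _)).
    have T2 : Num.max 0 (T - - T) = 2 * T by rewrite max_r; lra.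
    rewrite T2; apply: le_trans (small (2 * T) k _ _).
    + by apply: lee_wpmul2l => //; rewrite lee_fin mulr_ge0 ?ltW.
    + by rewrite mulr_ge0 ?ltW.
    + by rewrite /c; lra.
  - move=> k; have [_ _ _ _ [nuG _]] := GNP k.
    have mCc : measurable (~` C k) by exact: measurableC.
    apply: (@le_trans _ _ (frac_measure s ((C k `&` slab (- T) T) `*` ~` C k))).
      apply: (@le_measure _ _ _ (frac_measure s)); rewrite ?inE.
      + by apply: measurableX => //; exact: measurableI.
      + exact: measurableX.
      + by move=> [X Y] [[CX OX] CY]; split => //; split => //; exact: OT.
    apply: (le_trans (frac_measure_cylinder p0 (ltW T0) (mG k))).
    apply: le_trans (small _ k q0 _); last by rewrite /c; lra.
    by apply: lee_wpmul2l nuG; rewrite lee_fin.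
  - move=> k; have [clG oN KN NG _] := GNP k.
    (* the open neighbourhood of [K] inside [G] keeps the closure of [O \ C k]
       away from the cylinder over [K] *)
    have sub : closure (O `\` C k) `<=` closure O `&` ~` cylinder (GN k).2.
      have closedN : closed (~` cylinder (GN k).2 : set 'rV[R]_(n + 1)).
        by apply: open_closedC; exact: open_cylinder.
      move=> X clX; split; first by apply: closureS clX => Y [].
      move/closure_id : closedN => ->.
      by apply: closureS clX => Y [_ nCY] NY; apply: nCY; exact: NG.
    apply: minE.
    + by rewrite setDE; apply: openI => //; apply: closed_openC; exact: closed_cylinder.
    + apply: subclosed_compact compO _; first exact: closed_closure.
      by move=> X /sub[].
    + move=> X /sub[/OOmega OX NX]; split => // KX; apply: NX; exact: KN.
move=> O openO compO OOmega; split => //; last by move=> F mF; exact: le_per.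
have [U [openU OU compU UOmega nuU]] :=
  open_exhaustion_finite_perimeter s01 compO (open_cylinder openOmega) OOmega.
have mO : measurable (O : set (Rn R (n + 1))) by exact: measurable_open_rV.
have mU : measurable (U : set (Rn R (n + 1))) by exact: measurable_open_rV.
have mUc : measurable (~` U : set (Rn R (n + 1))) by exact: measurableC.
have mEU : measurable (E `\` U : set (Rn R (n + 1))) by exact: measurableD.
have OsubU : O `<=` U by exact: subset_trans (@subset_closure _ O) OU.
apply: (le_lt_trans (le_s_perimeter s mE mO mU OsubU)).
have EUU : (E `\` U) `\` U = E `\` U by rewrite setDDl setUid.
apply: (le_lt_trans (le_per U (E `\` U) openU compU UOmega mEU EUU)).
apply: le_lt_trans nuU; rewrite (frac_measure_swap s mU mUc) (s_perimeterE s mEU mU).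
apply: (@le_measure _ _ _ (frac_measure s)); rewrite ?inE.
- exact: measurable_crossing.
- exact: measurableX.
- by move=> [X Y] [/= [_ nUX] _ [|]].
Qed.
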